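(* Suppose the PKGTD algorithm (defined in the context) is run with constant learning rates $\alpha_t=\alpha$, $\beta_t=\beta$ and constant compression budget $\epsilon_t=\epsilon$, with $$0<\beta<1,\qquad \alpha=\beta,\qquad \epsilon=C\alpha^2,\qquad \lambda=G_V^2+\lambda_0,$$ where $C>0$ is a scalar and $0<\lambda_0<1$. Then, under Assumptions 1–3 and the norm bound listed in the context, the sub-optimality converges in mean to a neighborhood in the sense that $$\liminf_{t\to\infty}\mathbb E\big[\|V_t-V^*\|_{\mathcal H}^2\big]=\mathcal O(\alpha),$$ where the implied constant does not depend on $\alpha$ (it may depend on $C,\lambda_0$ and the constants $\sigma_\delta,G_\delta,G_V,\sigma_V,L_V,K$ of the assumptions).
   Context: **MDP and objective.** $(\mathcal X,\mathcal A,\mathbb P,r,\gamma)$ is a Markov decision process with state space $\mathcal X\subset\mathbb R^p$, action space $\mathcal A\subset\mathbb R^q$, transition law $\mathbf y\sim\mathbb P(\cdot\mid \mathbf x,\mathbf a)$, reward $r:\mathcal X\times\mathcal A\times\mathcal X\to\mathbb R$ and discount $\gamma\in(0,1)$. $\pi$ is a fixed stationary stochastic policy, and $\pi(\mathbf x)$ denotes the action it draws at $\mathbf x$. The state $\mathbf x$ has a distribution $\mu$ that is non-vanishing on all of $\mathcal X$, and $\mathbf y\sim\mathbb P(\cdot\mid\mathbf x,\pi(\mathbf x))$. $\mathcal H$ is a reproducing kernel Hilbert space (RKHS) of bounded continuous functions on $\mathcal X$ with kernel $\kappa:\mathcal X\times\mathcal X\to\mathbb R$. For $\lambda>0$, $$J(V)=\mathbb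 E_{\mathbf x,\pi(\mathbf x)}\Big\{\tfrac12\big(\mathbb E_{\mathbf y}[r(\mathbf x,\pi(\mathbf x),\mathbf y)+\gamma V(\mathbf y)-V(\mathbf x)\mid\mathbf x,\pi(\mathbf x)]\big)^2\Big\}+\tfrac{\lambda}{2}\|V\|_{\mathcal H}^2,\qquad V^*=\arg\min_{V\in\mathcal H}J(V),$$ and $\nabla_VJ$ is its Fréchet derivative. **PKGTD algorithm.** Initialize $V_0=0$, empty dictionary $\mathbf D_0$, empty weights, $z_0=0$. For $t=0,1,2,\dots$, with $(\mathbf x_t,\pi(\mathbf x_t),\mathbf y_t)$ i.i.d. copies of $(\mathbf x,\pi(\mathbf x),\mathbf y)$, step-sizes $\alpha_t>0$, $\beta_t\in(0,1)$ and compression budget $\epsilon_t>0$: 1. $\delta_t=r(\mathbf x_t,\pi(\mathbf x_t),\mathbf y_t)+\gamma V_t(\mathbf y_t)-V_t(\mathbf x_t)$ and $z_{t+1}=(1-\beta_t)z_t+\beta_t\delta_t$. 2. $\tilde V_{t+1}=(1-\alpha_t\lambda)V_t-\alpha_t(\gamma\kappa(\mathbf y_t,\cdot)-\kappa(\mathbf x_t,\cdot))z_{t+1}$, a kernel expansion over the dictionary $\tilde{\mathbf D}_{t+1}=[\mathbf D_t,\mathbf x_t,\mathbf y_t]$. 3. $(V_{t+1},\mathbf D_{t+1})=\mathrm{KOMP}(\tilde V_{t+1},\tilde{\mathbf D}_{t+1},\epsilon_t)$. KOMP (destructive kernel orthogonal matching pursuit): start from $\mathbf D=\tilde{\mathbf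 D}_{t+1}$, $V=\tilde V_{t+1}$. While $\mathbf D$ is nonempty, for each element $\mathbf d_j$ of $\mathbf D$ compute the distance $\gamma_j$ in $\|\cdot\|_{\mathcal H}$ from $\tilde V_{t+1}$ to $\mathrm{span}\{\kappa(\mathbf d,\cdot):\mathbf d\in\mathbf D\setminus\{\mathbf d_j\}\}$. Let $j^*$ minimize $\gamma_j$. If $\gamma_{j^*}>\epsilon_t$, stop. Otherwise remove $\mathbf d_{j^*}$ from $\mathbf D$ and let $V$ be the orthogonal projection of $\tilde V_{t+1}$ onto the span of the remaining kernels. Output $V,\mathbf D$. Thus, with $\mathcal H_{\mathbf D}=\mathrm{span}\{\kappa(\mathbf d,\cdot):\mathbf d\in\mathbf D\}$ and $\mathcal P_{\mathcal H_{\mathbf D}}$ the orthogonal projection onto it, $V_{t+1}=\mathcal P_{\mathcal H_{\mathbf D_{t+1}}}[\tilde V_{t+1}]$ and $\|V_{t+1}-\tilde V_{t+1}\|_{\mathcal H}\le\epsilon_t$. **Notation.** $\bar\delta_t=\mathbb E[\delta_t\mid\mathbf x_t,\pi(\mathbf x_t)]$ (with $V_t$ held fixed; convention $\bar\delta_{-1}=0$), and $\mathcal F_t$ is the sigma-algebra generated by $\{V_s,z_s,\mathbf x_s,\pi(\mathbf x_s),\mathbf y_s\}_{s=0}^{t-1}$. For a scalar $z$, $$\hat\nabla_VJ(V_t,z;\mathbf x_t,\pi(\mathbf x_t),\mathbf y_t)=(\gamma\kappa(\mathbf y_t,\cdot)-\kappa(\mathbf x_t,\cdot))z+\lambda V_t,$$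 $$\tilde\nabla_VJ(V_t,z_{t+1};\mathbf x_t,\pi(\mathbf x_t),\mathbf y_t)=\tfrac1{\alpha_t}\Big(V_t-\mathcal P_{\mathcal H_{\mathbf D_{t+1}}}\big[V_t-\alpha_t\hat\nabla_VJ(V_t,z_{t+1};\mathbf x_t,\pi(\mathbf x_t),\mathbf y_t)\big]\Big),$$ so $V_{t+1}=V_t-\alpha_t\tilde\nabla_VJ(V_t,z_{t+1};\mathbf x_t,\pi(\mathbf x_t),\mathbf y_t)$. **Assumptions** (conditional statements hold with probability 1). - *Assumption 1.* $\mathcal X$ and $\mathcal A$ are compact and $\sup_{\mathbf x\in\mathcal X}\sqrt{\kappa(\mathbf x,\mathbf x)}=X<\infty$. - *Assumption 2.* $\mathbb E[\delta_t\mid\mathbf x_t,\pi(\mathbf x_t)]=\bar\delta_t$, $\mathbb E[(\delta_t-\bar\delta_t)^2\mid\mathcal F_t]\le\sigma_\delta^2$, and $\mathbb E[z_{t+1}^2\mid\mathbf x_t,\pi(\mathbf x_t)]\le G_\delta^2$, for positive scalars $\sigma_\delta,G_\delta$. - *Assumption 3.* The quasi-gradient evaluated at $\bar\delta$ is unbiased: for fixed $V\in\mathcal H$ and $\bar\delta=\mathbb E_{\mathbf y}[r(\mathbf x,\pi(\mathbf x),\mathbf y)+\gamma V(\mathbf y)-V(\mathbf x)\mid\mathbf x,\pi(\mathbf x)]$, $\mathbb E[(\gamma\kappa(\mathbf y,\cdot)-\kappa(\mathbf x,\cdot))\bar\delta]+\lambda V=\nabla_VJ(V)$. Moreover $\mathbb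 E[\|\gamma\kappa(\mathbf y_t,\cdot)-\kappa(\mathbf x_t,\cdot)\|_{\mathcal H}^2\mid\mathcal F_t]\le G_V^2$ and $\mathbb E[\|\tilde\nabla_VJ(V_t,z_{t+1};\mathbf x_t,\pi(\mathbf x_t),\mathbf y_t)\|_{\mathcal H}^2\mid\mathcal F_t]\le\sigma_V^2$. Finally, mean temporal differences are Lipschitz in the value function with constant $L_V>0$: if $\bar\delta,\bar{\tilde\delta}$ are the mean temporal differences of $V,\tilde V\in\mathcal H$, then $|\bar\delta-\bar{\tilde\delta}|\le L_V\|V-\tilde V\|_{\mathcal H}$. This includes the mean temporal differences of consecutive iterates: $|\bar\delta_t-\bar\delta_{t-1}|\le L_V\|V_t-V_{t-1}\|_{\mathcal H}$ for $t\ge1$. - *Norm bound.* There is $K>0$ with $\|V_t\|_{\mathcal H}\le K$ for all $t$ and $\|V^*\|_{\mathcal H}\le K$. *)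

(* Defs.v *)
From HB Require Import structures.
From mathcomp Require Import all_boot all_order all_algebra.
From mathcomp Require Import all_classical all_reals all_analysis.

Set Implicit Arguments.
Unset Strict Implicit.
Unset Printing Implicit Defensive.

Import Order.TTheory GRing.Theory Num.Theory.
Import numFieldNormedType.Exports.

Local Open Scope classical_set_scope.
Local Open Scope ring_scope.

(** States and actions are row vectors.  The state space [X] and the action
    space [A] are sets of row vectors; a function on [X] is represented by a
    total function of which only the values on [X] are ever used, and
    integrals over states and actions are restricted to [X] and [A]. *)

Notation borel T := (g_sigma_algebraType (@open T)).

Section SigmaAlgebras.
Context {Omega : Type}.

(* Generators of the sigma-algebra of [f] (for the Borel sets of [T]). *)
Definition gen_by {T : topologicalType} (f : Omega -> T) : set (set Omega) :=
  preimage_set_system setT f open.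

Definition measurable_wrt (G : set (set Omega)) {T : topologicalType}
    (f : Omega -> T) : Prop :=
  forall U : set T, open U -> G (f @^-1` U).

End SigmaAlgebras.

Section ConditionalExpectation.
Context {d : measure_display} {Omega : measurableType d} {R : realType}.
Variables (Pr : probability Omega R) (G : set (set Omega)).

(* [W] is a version of E[Z | G]. *)
Definition is_cond_exp (Z W : Omega -> R) : Prop :=
  [/\ Pr.-integrable setT (EFin \o Z),
      Pr.-integrable setT (EFin \o W),
      measurable_wrt G W &
      forall B, G B -> (\int[Pr]_(w in B) (Z w)%:E = \int[Pr]_(w in B) (W w)%:E)%E].

(* E[Z | G] exists and is at most [c] with probability 1. *)
Definition cond_exp_le (Z : Omega -> R) (c : R) : Prop :=
  exists W, is_cond_exp Z W /\ {ae Pr, forall w, W w <= c}.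

End ConditionalExpectation.

(* Mutual independence of a sequence of random elements. *)
Definition mutually_independent {d d' : measure_display}
    {Omega : measurableType d} {S : measurableType d'} {R : realType}
    (Pr : probability Omega R) (f : nat -> Omega -> S) : Prop :=
  forall (I : seq nat) (B : nat -> set S),
    uniq I -> (forall i, measurable (B i)) ->
    fine (Pr (\bigcap_(i in [set` I]) (f i @^-1` B i))) =
    \prod_(i <- I) fine (Pr (f i @^-1` B i)).

Record MDP (R : realType) (p q : nat) := {
  state : set 'rV[R]_p;
  action : set 'rV[R]_q;
  trans : R.-pker (borel 'rV[R]_p * borel 'rV[R]_q)%type ~> borel 'rV[R]_p;
  reward : 'rV[R]_p -> 'rV[R]_q -> 'rV[R]_p -> R;
  discount : R;
  trans_state : forall x a, state x -> action a -> trans (x, a) state = 1%E;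
  reward_measurable : measurable_fun
    ((state `*` action `*` state) :
       set (borel 'rV[R]_p * borel 'rV[R]_q * borel 'rV[R]_p)%type)
    (fun s : (borel 'rV[R]_p * borel 'rV[R]_q * borel 'rV[R]_p)%type =>
       reward s.1.1 s.1.2 s.2);
  discount_gt0 : 0 < discount;
  discount_lt1 : discount < 1
}.

Record policy (R : realType) (p q : nat) (M : MDP R p q) := {
  draw :> R.-pker (borel 'rV[R]_p) ~> (borel 'rV[R]_q);
  draw_action : forall x, state M x -> draw x (action M) = 1%E
}.

(* Distribution of the state: carried by the state space, and giving positive
   mass to each of its nonempty relatively open subsets. *)
Record state_distribution (R : realType) (p q : nat) (M : MDP R p q) := {
  state_prob :> probability (borel 'rV[R]_p) R;
  state_prob_state : state_prob (state M) = 1%E;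
  state_prob_nonvanishing : forall U : set 'rV[R]_p, open U ->
    (U `&` state M) !=set0 -> (0 < state_prob (U `&` state M))%E
}.

(* A reproducing kernel Hilbert space of bounded continuous functions on [X]
   with kernel [kappa].  [hval f] is the element [f] seen as a function, and
   [ksec x] is the element kappa(x, .).  Completeness comes from the carrier
   [hsp], whose norm is the one induced by the inner product [ip]. *)
Record RKHS (R : realType) (p : nat) (X : set 'rV[R]_p) := {
  hsp :> completeNormedModType R;
  ip : {dot hsp for idfun};
  hval : hsp -> 'rV[R]_p -> R;
  kappa : 'rV[R]_p -> 'rV[R]_p -> R;
  ksec : 'rV[R]_p -> hsp;
  ip_norm : forall f : hsp, ip f f = `|f| ^+ 2;
  hval_inj : forall f g : hsp, (forall x, X x -> hval f x = hval g x) -> f = g;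
  hval_ksec : forall x y, X x -> X y -> hval (ksec x) y = kappa x y;
  reproducing : forall (f : hsp) x, X x -> hval f x = ip f (ksec x);
  hval_continuous : forall f : hsp, {within X, continuous (hval f)};
  hval_bounded : forall f : hsp, exists B : R, forall x, X x -> `|hval f x| <= B
}.

Section KOMP.
Context {R : realType} {p : nat} {X : set 'rV[R]_p} (H : RKHS X).

(* A dictionary is a list: removal acts on one entry, so that a point that
   occurs twice is not removed altogether. *)
Definition kspan (D : seq 'rV[R]_p) : set H :=
  [set h | exists c : nat -> R,
     h = \sum_(i < size D) c i *: ksec H (nth 0 D i)].

Definition remove_at (j : nat) (D : seq 'rV[R]_p) : seq 'rV[R]_p :=
  take j D ++ drop j.+1 D.

Definition hdist (f : H) (S : set H) : R := inf [set `|f - h| | h in S].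

(* Orthogonal projection onto [S]; the default value 0 is not used when [S] is
   a finite-dimensional subspace. *)
Definition oproj (S : set H) (f : H) : H :=
  xget 0 [set g | S g /\ forall h, S h -> ip H (f - g) h = 0].

Definition removal_error (f : H) (D : seq 'rV[R]_p) (j : nat) : R :=
  hdist f (kspan (remove_at j D)).

Definition least_error (f : H) (D : seq 'rV[R]_p) (j : nat) : Prop :=
  (j < size D)%N /\
  forall k, (k < size D)%N -> removal_error f D j <= removal_error f D k.

(* [komp f eps D V D' V']: pruning the expansion of [f] with budget [eps],
   the loop entered with dictionary [D] and current function [V] can exit with
   [D'] and [V'].  It is a relation because ties in the minimization of the
   removal error may be broken arbitrarily. *)
Inductive komp (f : H) (eps : R) :
    seq 'rV[R]_p -> H -> seq 'rV[R]_p -> H -> Prop :=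
| komp_empty V : komp f eps [::] V [::] V
| komp_stop D V j :
    least_error f D j -> eps < removal_error f D j -> komp f eps D V D V
| komp_prune D V j D' V' :
    least_error f D j -> removal_error f D j <= eps ->
    komp f eps (remove_at j D) (oproj (kspan (remove_at j D)) f) D' V' ->
    komp f eps D V D' V'.

End KOMP.

Arguments kspan {R p X} H D.

Section Objective.
Context {R : realType} {p q : nat} (M : MDP R p q) (pi : policy M)
  (mu : state_distribution M) (H : RKHS (state M)) (lam : R).

Let X := state M.
Let A := action M.

Definition td (V : H) (x : 'rV[R]_p) (a : 'rV[R]_q) (y : 'rV[R]_p) : R :=
  reward M x a y + discount M * hval V y - hval V x.

(* Mean temporal difference E_y[r(x,a,y) + gamma V(y) - V(x) | x, a]. *)
Definition mean_td (V : H) (x : 'rV[R]_p) (a : 'rV[R]_q) : R :=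
  \int[trans M (x, a)]_(y in X) td V x a y.

(* gamma kappa(y,.) - kappa(x,.) *)
Definition kdiff (x y : 'rV[R]_p) : H := discount M *: ksec H y - ksec H x.

Definition expect_xa (f : 'rV[R]_p -> 'rV[R]_q -> \bar R) : \bar R :=
  (\int[mu]_(x in X) \int[pi x]_(a in A) f x a)%E.

Definition expect_xay
    (f : 'rV[R]_p -> 'rV[R]_q -> 'rV[R]_p -> \bar R) : \bar R :=
  expect_xa (fun x a => \int[trans M (x, a)]_(y in X) f x a y)%E.

(* [m] is the H-valued expectation of [Z x a y]: [Z] is integrable in norm and
   its weak integral is [m]. *)
Definition is_hmean (Z : 'rV[R]_p -> 'rV[R]_q -> 'rV[R]_p -> H) (m : H) : Prop :=
  (expect_xay (fun x a y => (`|Z x a y|)%:E) < +oo)%E /\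
  forall h : H, expect_xay (fun x a y => (ip H (Z x a y) h)%:E) = (ip H m h)%:E.

(* Real-valued as soon as the temporal differences are square integrable. *)
Definition objective (V : H) : R :=
  fine (expect_xa (fun x a => (2^-1 * mean_td V x a ^+ 2)%:E))
  + lam / 2 * `|V| ^+ 2.

(* Frechet gradient, through the Riesz identification of H with its dual. *)
Definition is_gradient (J : H -> R) (V G : H) : Prop :=
  is_diff V (J : H -> R^o) (fun h => ip H G h : R^o).

End Objective.

Section Algorithm.
Context {d : measure_display} {Omega : measurableType d} {R : realType}
  {p q : nat} (M : MDP R p q) (pi : policy M) (mu : state_distribution M)
  (H : RKHS (state M)) (Pr : probability Omega R).
Variables (xs : nat -> Omega -> 'rV[R]_p) (acts : nat -> Omega -> 'rV[R]_q)
  (ys : nat -> Omega -> 'rV[R]_p).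
Variables (V : nat -> Omega -> H) (z : nat -> Omega -> R)
  (D : nat -> Omega -> seq 'rV[R]_p).
Variables (alpha beta eps : nat -> R) (lam : R).

Definition sample (t : nat) (w : Omega) :
    (borel 'rV[R]_p * borel 'rV[R]_q * borel 'rV[R]_p)%type :=
  (xs t w, acts t w, ys t w).

(* The samples are i.i.d. copies of (x, pi(x), y), with values in the state
   and action spaces. *)
Record iid_samples : Prop := {
  sample_range : forall t w,
    [/\ state M (xs t w), action M (acts t w) & state M (ys t w)];
  sample_measurable : forall t, measurable_fun setT (sample t);
  sample_law : forall t
      (B : set (borel 'rV[R]_p * borel 'rV[R]_q * borel 'rV[R]_p)%type),
    measurable B ->
    Pr (sample t @^-1` B) =
    expect_xa pi mu (fun x a => trans M (x, a) [set y | B (x, a, y)]);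
  sample_independent : mutually_independent Pr sample
}.

Definition delta (t : nat) (w : Omega) : R :=
  td (V t w) (xs t w) (acts t w) (ys t w).

Definition mean_delta (t : nat) (w : Omega) : R :=
  mean_td (V t w) (xs t w) (acts t w).

Definition Vtilde (t : nat) (w : Omega) : H :=
  (1 - alpha t * lam) *: V t w
  - (alpha t * z t.+1 w) *: kdiff H (xs t w) (ys t w).

Definition Dtilde (t : nat) (w : Omega) : seq 'rV[R]_p :=
  D t w ++ [:: xs t w; ys t w].

Record pkgtd : Prop := {
  V_init : forall w, V 0 w = 0;
  D_init : forall w, D 0 w = [::];
  z_init : forall w, z 0 w = 0;
  z_step : forall t w, z t.+1 w = (1 - beta t) * z t w + beta t * delta t w;
  V_step : forall t w,
    komp (Vtilde t w) (eps t) (Dtilde t w) (Vtilde t w) (D t.+1 w) (V t.+1 w)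
}.

(* The filtration F_t, generated by V_s, z_s, x_s, pi(x_s), y_s for s < t. *)
Definition filtr (t : nat) : set (set Omega) :=
  <<s \bigcup_(s in [set s | (s < t)%N])
        (gen_by (V s) `|` gen_by (z s) `|`
         gen_by (xs s) `|` gen_by (acts s) `|` gen_by (ys s)) >>.

Definition sigma_xa (t : nat) : set (set Omega) :=
  <<s gen_by (xs t) `|` gen_by (acts t) >>.

Definition filtr_xa (t : nat) : set (set Omega) :=
  <<s filtr t `|` gen_by (xs t) `|` gen_by (acts t) >>.

(* The iterates only use past information, ties in the compression step
   included. *)
Definition adapted_iterates : Prop := forall t, measurable_wrt (filtr t) (V t).

Definition hat_grad (t : nat) (w : Omega) (zeta : R) : H :=
  zeta *: kdiff H (xs t w) (ys t w) + lam *: V t w.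

Definition tilde_grad (t : nat) (w : Omega) : H :=
  (alpha t)^-1 *: (V t w - oproj (kspan H (D t.+1 w))
                             (V t w - alpha t *: hat_grad t w (z t.+1 w))).

Definition assumption1 : Prop :=
  [/\ compact (state M), compact (action M) &
      has_ubound [set Num.sqrt (kappa H x x) | x in state M]].

(* The conditional expectation of the temporal difference given the current
   state and action is taken with V_t held fixed, i.e. given F_t as well. *)
Record assumption2 (sigma_delta G_delta : R) : Prop := {
  td_unbiased : forall t, is_cond_exp Pr (filtr_xa t) (delta t) (mean_delta t);
  td_variance : forall t, cond_exp_le Pr (filtr t)
    (fun w => (delta t w - mean_delta t w) ^+ 2) (sigma_delta ^+ 2);
  z_second_moment : forall t, cond_exp_le Pr (sigma_xa t)
    (fun w => z t.+1 w ^+ 2) (G_delta ^+ 2)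
}.

Record assumption3 (G_V sigma_V L_V : R) : Prop := {
  quasi_gradient_unbiased : forall W : H, exists m : H,
    is_hmean pi mu (fun x a y => mean_td W x a *: kdiff H x y) m /\
    is_gradient (objective pi mu (H := H) lam) W (m + lam *: W);
  kdiff_second_moment : forall t, cond_exp_le Pr (filtr t)
    (fun w => `|kdiff H (xs t w) (ys t w)| ^+ 2) (G_V ^+ 2);
  grad_second_moment : forall t, cond_exp_le Pr (filtr t)
    (fun w => `|tilde_grad t w| ^+ 2) (sigma_V ^+ 2);
  mean_td_lipschitz : forall W W' : H,
    {ae (mu : set (borel 'rV[R]_p) -> \bar R), forall x, state M x ->
      {ae (pi x : set (borel 'rV[R]_q) -> \bar R), forall a, action M a ->
        `|mean_td W x a - mean_td W' x a| <= L_V * `|W - W'|}};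
  mean_delta_lipschitz : forall t,
    {ae Pr, forall w, `|mean_delta t.+1 w - mean_delta t w|
                      <= L_V * `|V t.+1 w - V t w|}
}.

Definition norm_bound (Vstar : H) (K : R) : Prop :=
  {ae Pr, forall w, forall t, `|V t w| <= K} /\ `|Vstar| <= K.

End Algorithm.

(* Main.v *)
Require Import Defs.
From HB Require Import structures.
From mathcomp Require Import all_boot all_order all_algebra.
From mathcomp Require Import all_classical all_reals all_analysis.
From mathcomp Require Import measurable_realfun.
From mathcomp Require Import ring lra.

Set Implicit Arguments.
Unset Strict Implicit.
Unset Printing Implicit Defensive.

Import Order.TTheory GRing.Theory Num.Theory.
Import numFieldNormedType.Exports.

Local Open Scope classical_set_scope.
Local Open Scope ring_scope.

(** The compressed iteration moves V_t and z_t on the same time scale, so neither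
    error can be bounded alone.  The proof uses the Lyapunov function
    |V_t - V*|^2 + (z_t - c)^2, where c is the mean of the temporal difference at
    V* over the law of a sample.  In its one-step drift the cross terms
    <V_t - V*, gamma kappa(y_t,.) - kappa(x_t,.)> (z_t - c) cancel, because
    delta_t minus the temporal difference at V* is exactly that inner product.
    What is left at first order in alpha is
    - (z_t - c)^2 - lambda |V_t - V*|^2, up to the squared change of the mean
    temporal difference over one step (which is O(alpha^2) in mean) and terms
    with mean 0.  The latter rest on the independence of the sample from the past,
    on the unbiasedness of delta_t, and on the optimality of V*, which says that
    E[(gamma kappa(y,.) - kappa(x,.)) deltabar*] = - lambda V*.  Hence the mean of
    the Lyapunov function is contracted by 1 - alpha lambda_0 up to O(alpha^2). *)

(** The obstacle is a mismatch of centers. Optimality weights the kernel difference by the mean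
    temporal difference at [Vstar], which varies with state and action ([dsb]), whereas z_t is
    centered at the constant [c]. The drift thus keeps a first-order term [ek * (dsb - c)] without
    sign, where [ek] is delta_t minus the temporal difference [ds] at [Vstar]. It is treated factor
    by factor. In mean, delta_t may be replaced by its conditional mean. That one is replaced by the
    conditional mean of the previous step, which is uncorrelated with the fresh [dsb - c]; this is
    why the recursion only starts at time 1. The remaining [ds * (dsb - c)] has the mean of
    [(dsb - c) ^+ 2] and enters negatively, so it absorbs by Young's inequality the cost of going
    back one step. The variance of [ds] must not enter the final constant either; it is avoided by
    comparing temporal differences of consecutive, independent samples. Freezing the past inside a
    mean requires random elements of H to be evaluated at random points measurably, and the law of a
    sample to be used for signed nested integrals; much of the development serves these two
    purposes. *)

(** * Inner product calculus in the Hilbert space *)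

Section InnerProduct.
Context {R : realType} {p : nat} {X : set 'rV[R]_p} (H : RKHS X).
Implicit Types (f g h : H) (a : R).

Lemma ipC f g : ip H f g = ip H g f.
Proof. by rewrite hermC /= expr0 mul1r. Qed.

Lemma ipDl f g h : ip H (f + g) h = ip H f h + ip H g h.
Proof. by rewrite linearDl. Qed.

Lemma ipZl a f h : ip H (a *: f) h = a * ip H f h.
Proof. by rewrite linearZl_LR. Qed.

Lemma ipNl f h : ip H (- f) h = - ip H f h.
Proof. by rewrite linearNl. Qed.

Lemma ipBl f g h : ip H (f - g) h = ip H f h - ip H g h.
Proof. by rewrite ipDl ipNl. Qed.

Lemma ip0l h : ip H 0 h = 0.
Proof. by rewrite linear0l. Qed.

Lemma ipDr f g h : ip H f (g + h) = ip H f g + ip H f h.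
Proof. by rewrite ipC ipDl !(ipC _ f). Qed.

Lemma ipZr a f h : ip H f (a *: h) = a * ip H f h.
Proof. by rewrite ipC ipZl ipC. Qed.

Lemma ipNr f h : ip H f (- h) = - ip H f h.
Proof. by rewrite ipC ipNl ipC. Qed.

Lemma ipBr f g h : ip H f (g - h) = ip H f g - ip H f h.
Proof. by rewrite ipDr ipNr. Qed.

Lemma ip0r h : ip H h 0 = 0.
Proof. by rewrite ipC ip0l. Qed.

Lemma ip_normD f g : `|f + g| ^+ 2 = `|f| ^+ 2 + 2 * ip H f g + `|g| ^+ 2.
Proof. by rewrite -!ip_norm ipDl !ipDr (ipC g f); ring. Qed.

(** Expanding the squared norm of [|g| f - s |f| g] for [s = 1] and [s = -1] bounds the inner
    product from both sides. *)
Lemma cauchy_schwarz f g : `|ip H f g| <= `|f| * `|g|.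
Proof.
have [->|f0] := eqVneq f 0; first by rewrite ip0l !normr0 mul0r.
have [->|g0] := eqVneq g 0; first by rewrite ip0r !normr0 mulr0.
have F : 0 < `|f| by rewrite normr_gt0.
have G : 0 < `|g| by rewrite normr_gt0.
have key (s : R) : s ^+ 2 = 1 -> s * ip H f g <= `|f| * `|g|.
  move=> s1; have : 0 <= `|(`|g| *: f) - (s * `|f|) *: g| ^+ 2 by rewrite sqr_ge0.
  rewrite -ip_norm !(ipBl, ipBr, ipZl, ipZr) (ipC g f) !ip_norm => h.
  have FG : 0 < `|f| * `|g| by rewrite mulr_gt0.
  rewrite -(ler_pM2l FG); move: h.
  set x := `|f|; set y := `|g|; set i := ip H f g => h.
  have -> : x * y * (x * y) = (x * y) ^+ 2 * (1 + s ^+ 2) / 2 by rewrite s1; field.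
  nra.
by rewrite ler_norml -[ip H f g]mul1r key ?expr1n// lerNl -mulNr key// sqrrN expr1n.
Qed.

Lemma eq_ip f g : (forall h, ip H f h = ip H g h) -> f = g.
Proof.
move=> fg; apply/eqP; rewrite -subr_eq0 -normr_eq0 -sqrf_eq0 -ip_norm.
by rewrite ipBl fg subrr.
Qed.

Lemma continuous_ipl h : continuous (fun f : H => ip H f h : R^o).
Proof.
move=> f; apply/cvgrPdist_le => e e0; near=> g.
rewrite -ipBl (le_trans (cauchy_schwarz _ _))//.
have B : 0 < `|h| + 1 by rewrite ltr_wpDl.
have : `|f - g| <= e / (`|h| + 1).
  by near: g; apply: cvgr_dist_le; [exact: cvg_id|exact: divr_gt0].
rewrite ler_pdivlMr// => /(le_trans _); apply.
by rewrite ler_wpM2l// lerDl.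
Unshelve. all: by end_near.
Qed.

End InnerProduct.

(** * Projections onto spans of kernels, and the outcome of pruning *)

Section Compression.
Context {R : realType} {p : nat} {X : set 'rV[R]_p} (H : RKHS X).
Implicit Types (f g h : H) (D : seq 'rV[R]_p).

Lemma kspan_nil h : kspan H [::] h -> h = 0.
Proof. by move=> [c ->]; rewrite big_ord0. Qed.

Lemma kspan_cons x D h : kspan H (x :: D) h <->
  exists a h', kspan H D h' /\ h = a *: ksec H x + h'.
Proof.
split=> [[c ->]|[a [h' [[c ->] ->]]]].
  exists (c 0%N), (\sum_(i < size D) c i.+1 *: ksec H (nth 0 D i)); split.
    by exists (fun i => c i.+1).
  by rewrite big_ord_recl.
exists (fun i => if i is j.+1 then c j else a).
by rewrite big_ord_recl.
Qed.

Lemma kspan0 D : kspan H D 0.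
Proof. by exists (fun=> 0); rewrite big1// => i _; rewrite scale0r. Qed.

Lemma kspanD D f g : kspan H D f -> kspan H D g -> kspan H D (f + g).
Proof.
move=> [b ->] [c ->]; exists (fun i => b i + c i); rewrite -big_split/=.
by apply: eq_bigr => i _; rewrite scalerDl.
Qed.

Lemma kspanZ D a f : kspan H D f -> kspan H D (a *: f).
Proof.
move=> [b ->]; exists (fun i => a * b i); rewrite scaler_sumr.
by apply: eq_bigr => i _; rewrite scalerA.
Qed.

Lemma kspanB D f g : kspan H D f -> kspan H D g -> kspan H D (f - g).
Proof. by move=> F G; rewrite -scaleN1r; apply: kspanD => //; exact: kspanZ. Qed.

Lemma kspan_ksec D x : x \in D -> kspan H D (ksec H x).
Proof.
elim: D => // y D ih; rewrite inE => /predU1P[->|/ih xD]; apply/kspan_cons.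
  by exists 1, 0; split; [exact: kspan0|rewrite scale1r addr0].
by exists 0, (ksec H x); rewrite scale0r add0r.
Qed.

Lemma kspan_catl D D' f : kspan H D f -> kspan H (D ++ D') f.
Proof.
elim: D f => [|x D ih] f; first by move=> /kspan_nil ->; exact: kspan0.
move=> /kspan_cons[a [h [Dh ->]]]; apply/kspan_cons; exists a, h.
by split=> //; exact: ih.
Qed.

(* One step of Gram-Schmidt per dictionary element. *)
Lemma kspan_projection D f :
  exists g, kspan H D g /\ forall h, kspan H D h -> ip H (f - g) h = 0.
Proof.
elim: D f => [|x D ih] f.
  by exists 0; split; [exact: kspan0|move=> h /kspan_nil ->; rewrite ip0r].
have [g [Dg gP]] := ih f; have [k [Dk kP]] := ih (ksec H x).
(* [u] is the part of the new kernel section orthogonal to the old span; it vanishes when the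
   section is redundant, and then the old projection still serves. *)
pose u := ksec H x - k; have [u0|u0] := eqVneq u 0.
  exists g; split.
    by apply/kspan_cons; exists 0, g; rewrite scale0r add0r.
  move=> _ /kspan_cons[a [h [Dh ->]]].
  move/eqP: u0; rewrite subr_eq0 => /eqP ->.
  by rewrite gP//; apply: kspanD => //; exact: kspanZ.
have uu : ip H u u != 0 by rewrite ip_norm sqrf_eq0 normr_eq0.
pose b := ip H f u / ip H u u.
exists (g + b *: u); split.
  apply/kspan_cons; exists b, (g - b *: k); split.
    by apply: kspanB => //; exact: kspanZ.
  by rewrite scalerBr addrCA.
move=> _ /kspan_cons[a [h [Dh ->]]].
have ug h' : kspan H D h' -> ip H u h' = 0 by exact: kP.
have -> : a *: ksec H x + h = a *: u + (a *: k + h).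
  by rewrite scalerBr addrA subrK.
have Dh' : kspan H D (a *: k + h) by apply: kspanD => //; exact: kspanZ.
move: (a *: k + h) Dh' => h' Dh'.
rewrite opprD addrA (ipBl (f - g)) !ipDr !ipZr !ipZl (gP h')// (ug h')// mulr0 !addr0.
rewrite (ipBl f g) (ipC g) (ug g)// subr0 /b; by field.
Qed.

Lemma oprojP D f : kspan H D (oproj (kspan H D) f) /\
  forall h, kspan H D h -> ip H (f - oproj (kspan H D) f) h = 0.
Proof.
have [g gP] := kspan_projection D f.
by rewrite /oproj; case: xgetP => [_ -> []//|/(_ g)].
Qed.

Lemma oproj_id D f : kspan H D f -> oproj (kspan H D) f = f.
Proof.
move=> Df; have [Dp orth] := oprojP D f.
apply/esym/eqP; rewrite -subr_eq0 -normr_eq0 -sqrf_eq0 -ip_norm.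
by rewrite orth//; exact: kspanB.
Qed.

(** By Pythagoras the infimum is attained at the projection. *)
Lemma hdist_oproj D f : hdist f (kspan H D) = `|f - oproj (kspan H D) f|.
Proof.
have [Dp orth] := oprojP D f; set g := oproj _ f in Dp orth *.
have lb : lbound [set `|f - h| | h in kspan H D] `|f - g|.
  move=> _ [h Dh <-]; rewrite -ler_sqr ?nnegrE//.
  have -> : f - h = (f - g) + (g - h) by rewrite addrA subrK.
  rewrite [leRHS]ip_normD orth ?mulr0 ?addr0 ?lerDl ?sqr_ge0//.
  exact: kspanB.
have in_set : [set `|f - h| | h in kspan H D] `|f - g| by exists g.
apply/eqP; rewrite eq_le; apply/andP; split.
  by apply: ge_inf in_set; exists (`|f - g|).
by apply: lb_le_inf; [exists (`|f - g|)|exact: lb].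
Qed.

(** Each removal projects the original [f], not the current function, so errors do not accumulate:
    the last removal alone determines the output and its error. *)
Lemma komp_dichotomy f eps D V D' V' : komp f eps D V D' V' ->
  (D' = D /\ V' = V) \/
  (V' = oproj (kspan H D') f /\ `|f - V'| <= eps).
Proof.
elim=> [|D0 V0 j _ _|D0 V0 j D1 V1 _ jeps _ [[-> ->]|]]; [by left|by left| |by right].
by right; split => //; rewrite -hdist_oproj.
Qed.

(** If nothing is removed, the output is [f], which is its own projection because it lies in the
    span of the dictionary. *)
Lemma komp_oproj f eps D D' V' : 0 <= eps -> kspan H D f ->
  komp f eps D f D' V' -> V' = oproj (kspan H D') f /\ `|f - V'| <= eps.
Proof.
move=> eps0 Df /komp_dichotomy[[-> ->]|//].
by rewrite oproj_id// subrr normr0.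
Qed.

End Compression.

(** * Integrable and square integrable random variables *)

Section Moments.
Context {d : measure_display} {Omega : measurableType d} {R : realType}
  (Pr : probability Omega R).
Implicit Types (f g : Omega -> R) (a : R).

Definition L1 f := Pr.-integrable setT (EFin \o f).
(** Measurability of [f] is required separately, since that of its square does not imply it. *)
Definition L2 f := measurable_fun setT f /\ L1 (fun w => f w ^+ 2).
Definition mean f : R := \int[Pr]_w f w.

Lemma L1_measurable f : L1 f -> measurable_fun setT f.
Proof. by move=> /measurable_int/measurable_EFinP. Qed.

Lemma L1_cst a : L1 (cst a).
Proof. exact: finite_measure_integrable_cst. Qed.

Lemma L1D f g : L1 f -> L1 g -> L1 (fun w => f w + g w).
Proof.
by move=> F G; have := integrableD measurableT F G; apply: eq_integrable.
Qed.

Lemma L1Z a f : L1 f -> L1 (fun w => a * f w).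
Proof.
by move=> F; have := integrableZl measurableT a F; apply: eq_integrable.
Qed.

Lemma L1N f : L1 f -> L1 (fun w => - f w).
Proof. by move=> /(L1Z (-1)); under eq_fun do rewrite mulN1r. Qed.

Lemma L1B f g : L1 f -> L1 g -> L1 (fun w => f w - g w).
Proof. by move=> F G; apply: L1D => //; exact: L1N. Qed.

Lemma ae_le_L1 f g : measurable_fun setT f ->
  {ae Pr, forall w, `|f w| <= g w} -> L1 g -> L1 f.
Proof.
move=> mf fg G; apply/integrableP; split; first exact/measurable_EFinP.
have /integrableP[mg] := G; apply: le_lt_trans.
apply: ae_ge0_le_integral => //.
- by apply: measurableT_comp => //; exact/measurable_EFinP.
- exact: measurableT_comp.
- apply: filterS fg => w fg _ /=; rewrite lee_fin.
  exact: le_trans (ler_norm _).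
Qed.

Lemma le_L1 f g : measurable_fun setT f -> (forall w, `|f w| <= g w) ->
  L1 g -> L1 f.
Proof. by move=> mf fg; apply: ae_le_L1 => //; exact: aeW. Qed.

Lemma bounded_L1 f a : measurable_fun setT f ->
  {ae Pr, forall w, `|f w| <= a} -> L1 f.
Proof. by move=> mf fa; apply: (@ae_le_L1 f (cst a)) => //; exact: L1_cst. Qed.

Lemma L2M f g : L2 f -> L2 g -> L1 (fun w => f w * g w).
Proof.
move=> [mf f2] [mg g2]; apply: le_L1 (L1D f2 g2); first exact: measurable_funM.
move=> w; rewrite normrM -[leRHS]addr0 -(subrr (2 * (`|f w| * `|g w|))).
rewrite -[f w ^+ 2]real_normK ?num_real// -[g w ^+ 2]real_normK ?num_real//.
have := sqr_ge0 (`|f w| - `|g w|); have := normr_ge0 (f w).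
have := normr_ge0 (g w); nra.
Qed.

Lemma L2_cst a : L2 (cst a).
Proof. by split=> //; exact: (L1_cst (a ^+ 2)). Qed.

Lemma L2_L1 f : L2 f -> L1 f.
Proof.
by move=> /(L2M (L2_cst 1)); rewrite /cst; under eq_fun do rewrite mul1r.
Qed.

Lemma L2D f g : L2 f -> L2 g -> L2 (fun w => f w + g w).
Proof.
move=> F G; split; first by case: F G => mf _ [mg _]; exact: measurable_funD.
under eq_fun do rewrite sqrrD.
by apply: L1D G.2; apply: L1D F.2 _; under eq_fun do rewrite -mulr_natl;
  apply: L1Z; exact: L2M.
Qed.

Lemma L2Z a f : L2 f -> L2 (fun w => a * f w).
Proof.
move=> [mf F]; split; first exact: measurable_funM.
by under eq_fun do rewrite exprMn; exact: L1Z.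
Qed.

Lemma L2N f : L2 f -> L2 (fun w => - f w).
Proof. by move=> /(L2Z (-1)); under eq_fun do rewrite mulN1r. Qed.

Lemma L2B f g : L2 f -> L2 g -> L2 (fun w => f w - g w).
Proof. by move=> F G; apply: L2D => //; exact: L2N. Qed.

Lemma ae_le_L2 f g : measurable_fun setT f ->
  {ae Pr, forall w, `|f w| <= g w} -> L2 g -> L2 f.
Proof.
move=> mf fg [mg G]; split=> //; apply: ae_le_L1 G; first exact: measurable_funX.
apply: filterS fg => w fg; rewrite normrX.
by rewrite ler_sqr ?nnegrE// (le_trans _ fg).
Qed.

Lemma bounded_L2 f a : measurable_fun setT f ->
  {ae Pr, forall w, `|f w| <= a} -> L2 f.
Proof. by move=> mf fa; apply: (@ae_le_L2 f (cst a)) => //; exact: L2_cst. Qed.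

Lemma meanD f g : L1 f -> L1 g -> mean (fun w => f w + g w) = mean f + mean g.
Proof. by move=> F G; exact: RintegralD. Qed.

Lemma meanB f g : L1 f -> L1 g -> mean (fun w => f w - g w) = mean f - mean g.
Proof. by move=> F G; exact: RintegralB. Qed.

Lemma meanZ a f : L1 f -> mean (fun w => a * f w) = a * mean f.
Proof. by move=> F; exact: RintegralZl. Qed.

Lemma mean_cst a : mean (cst a) = a.
Proof.
by rewrite /mean (Rintegral_cst Pr)// [X in fine X](@probability_setT _ _ _ Pr) mulr1.
Qed.

Lemma meanE f : L1 f -> (mean f)%:E = (\int[Pr]_w (f w)%:E)%E.
Proof. by move=> F; rewrite /mean/Rintegral fineK//; exact: integrable_fin_num. Qed.

Lemma L1_sum (I : Type) (r : seq I) (F : I -> Omega -> R) :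
  (forall i, L1 (F i)) -> L1 (fun w => \sum_(i <- r) F i w).
Proof.
move=> LF; elim: r => [|i r ih].
  by under eq_fun do rewrite big_nil; exact: L1_cst.
by under eq_fun do rewrite big_cons; exact: L1D.
Qed.

Lemma mean_sum (I : Type) (r : seq I) (F : I -> Omega -> R) :
  (forall i, L1 (F i)) ->
  mean (fun w => \sum_(i <- r) F i w) = \sum_(i <- r) mean (F i).
Proof.
move=> LF; elim: r => [|i r ih].
  by under [in LHS]eq_fun do rewrite big_nil; rewrite big_nil; exact: mean_cst.
under [in LHS]eq_fun do rewrite big_cons.
by rewrite big_cons meanD// ?ih//; exact: L1_sum.
Qed.

Lemma ae_le_mean f g : L1 f -> L1 g -> {ae Pr, forall w, f w <= g w} ->
  mean f <= mean g.
Proof.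
move=> F G fg; rewrite -subr_ge0 -meanB//.
have mB := L1_measurable (L1B G F).
rewrite -lee_fin meanE; last exact: L1B.
(* The difference is nonnegative only almost everywhere; its positive part is so everywhere and has
   the same integral. *)
rewrite (ae_eq_integral (fun w => (Num.max (g w - f w) 0)%:E))//.
- by apply: integral_ge0 => w _; rewrite lee_fin le_max lexx orbT.
- exact/measurable_EFinP.
- by apply/measurable_EFinP; exact: measurable_maxr.
- by apply: filterS fg => w fg _; rewrite max_l// subr_ge0.
Qed.

Lemma ae_eq_mean f g : L1 f -> L1 g -> {ae Pr, forall w, f w = g w} ->
  mean f = mean g.
Proof.
move=> F G fg; apply/eqP; rewrite eq_le; apply/andP.
by split; apply: ae_le_mean => //; apply: filterS fg => w ->.
Qed.

End Moments.

(** * Products with a factor of zero conditional mean *)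

Section Conditioning.
Context {d : measure_display} {Omega : measurableType d} {R : realType}
  (Pr : probability Omega R) (S : set (set Omega)).
Hypothesis S_measurable : S `<=` measurable.
Local Notation T2 := (g_sigma_algebraType S).

Lemma sub_g_measurable (B : set Omega) : <<s S >> B -> measurable B.
Proof.
by apply: smallest_sub => //; exact: sigma_algebra_measurable.
Qed.

(** [T2] is [Omega] with the sigma-algebra generated by [S]; composing with the identity turns maps
    measurable for it into random variables on [Omega]. *)
Lemma measurable_id_g : measurable_fun setT (id : Omega -> T2).
Proof. by move=> _ B mB; rewrite setTI; exact: sub_g_measurable. Qed.

Lemma measurable_fun_g {d'} {T : measurableType d'} (U : T2 -> T) :
  measurable_fun setT U -> measurable_fun [set: Omega] (U : Omega -> T).
Proof. by move=> mU; exact: (measurableT_comp mU measurable_id_g). Qed.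

Import HBNNSimple.

(** For the indicator of a conditioning event this is the hypothesis; linearity gives simple
    functions, and convergence dominated by [|Z U|] gives nonnegative [U]. *)
Let mean_mul_ge0_eq0 (Z U : Omega -> R) : L1 Pr Z ->
  (forall B, <<s S >> B -> (\int[Pr]_(w in B) (Z w)%:E = 0)%E) ->
  measurable_fun setT (U : T2 -> R) -> (forall w, 0 <= U w) ->
  L1 Pr (fun w => Z w * U w) -> mean Pr (fun w => Z w * U w) = 0.
Proof.
move=> LZ Z0 mU U0 LZU.
have mEU : measurable_fun setT (EFin \o U : T2 -> \bar R).
  exact/measurable_EFinP.
pose u := nnsfun_approx (measurableT : measurable [set: T2]) mEU.
have U0' (w : T2) : setT w -> (0 <= (EFin \o U) w)%E by rewrite /= lee_fin.
have cvg_u w := cvg_nnsfun_approx (measurableT : measurable [set: T2]) mEU U0'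
  (x := w) I.
have uU n (w : T2) : u n w <= U w.
  rewrite -lee_fin; apply: cvge_ge (cvg_u w); exists n => // m /= nm.
  by rewrite lee_fin; exact/lefP/nd_nnsfun_approx.
have mu_ n : measurable_fun [set: Omega] (u n : Omega -> R).
  by apply: measurable_fun_g.
have mZ := L1_measurable LZ.
have mean_indic (B : set T2) : measurable B ->
    L1 Pr (fun w => Z w * \1_B w) /\ mean Pr (fun w => Z w * \1_B w) = 0.
  move=> mB; have mB' : measurable (B : set Omega) by exact: sub_g_measurable.
  have LB : L1 Pr (fun w => Z w * \1_B w).
    apply: le_L1 (integrable_norm LZ) => //.
      by apply: measurable_funM => //; exact: measurable_indic.
    move=> w; rewrite /= normrM -[leRHS]mulr1 ler_wpM2l// indicE.
    by case: (_ \in _); rewrite ?normr0 ?normr1.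
  split=> //; apply/EFin_inj; rewrite meanE//.
  apply: etrans (Z0 _ mB); rewrite [RHS]integral_mkcond.
  apply: eq_integral => w _; rewrite patchE indicE.
  by case: (w \in B); rewrite ?mulr1 ?mulr0.
have step n : (\int[Pr]_w (Z w * u n w)%:E = 0)%E.
  pose F r w := r * (Z w * \1_(u n @^-1` [set r]) w).
  have LF r : L1 Pr (F r) /\ mean Pr (F r) = 0.
    have [L m0] := mean_indic _ (measurable_funPTI (u n) (measurable_set1 r)).
    by split; [exact: L1Z|rewrite /F meanZ// m0 mulr0].
  have uF w : Z w * u n w = \sum_(r <- finmap.enum_fset (fset_set (range (u n)))) F r w.
    rewrite (fimfunE (u n)) fsbig_finite//= mulr_sumr.
    by apply: eq_bigr => r _; rewrite mulrCA.
  under eq_integral do rewrite uF.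
  rewrite -meanE; last by apply: L1_sum => i; case: (LF i).
  rewrite mean_sum; last by move=> i; case: (LF i).
  by rewrite big1// => i _; case: (LF i).
have [|||||_ _] := @dominated_convergence _ _ _ Pr setT measurableT
  (fun n w => (Z w * u n w)%:E) (fun w => (Z w * U w)%:E)
  (fun w => `|Z w * U w|%:E).
- by move=> n; apply/measurable_EFinP; exact: measurable_funM.
- by apply/measurable_EFinP; exact: L1_measurable LZU.
- apply: aeW => w _; rewrite EFinM; under eq_fun do rewrite EFinM.
  by apply: cvgeZl => //; exact: cvg_u.
- exact: integrable_norm LZU.
- apply: aeW => w n _; rewrite /= lee_fin !normrM ler_wpM2l//.
  by rewrite !ger0_norm.
rewrite /= => cvg0; apply/EFin_inj; rewrite meanE//.
move/cvg_lim : cvg0 => <-//.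
by under eq_fun do rewrite step; rewrite lim_cst.
Qed.

(* The "taking out what is known" rule, for a conditional mean equal to 0. *)
Lemma mean_mul_eq0 (Z U : Omega -> R) : L1 Pr Z ->
  (forall B, <<s S >> B -> (\int[Pr]_(w in B) (Z w)%:E = 0)%E) ->
  measurable_fun setT (U : T2 -> R) ->
  L1 Pr (fun w => Z w * U w) -> mean Pr (fun w => Z w * U w) = 0.
Proof.
move=> LZ Z0 mU LZU.
have mU' : measurable_fun [set: Omega] U by exact: measurable_fun_g.
have mZ := L1_measurable LZ.
(* [s = 1] and [s = -1] select the positive and the negative part of [U], so that one argument
   handles both. *)
have le_part (s : R) w : `|s| = 1 ->
    `|Z w * Num.max (s * U w) 0| <= `|Z w * U w|.
  move=> s1; rewrite !normrM ler_wpM2l// ger0_norm ?le_max ?lexx ?orbT//.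
  by rewrite ge_max normr_ge0 andbT (le_trans (ler_norm _))// normrM s1 mul1r.
have L (s : R) : `|s| = 1 -> L1 Pr (fun w => Z w * Num.max (s * U w) 0).
  move=> s1; apply: le_L1 (integrable_norm LZU).
    apply: measurable_funM => //.
    by apply: measurable_maxr => //; exact: measurable_funM.
  by move=> w; exact: le_part.
have M (s : R) : `|s| = 1 -> mean Pr (fun w => Z w * Num.max (s * U w) 0) = 0.
  move=> s1; apply: mean_mul_ge0_eq0 => //; last exact: L.
  - by apply: measurable_maxr => //; exact: measurable_funM.
  - by move=> w; rewrite le_max lexx orbT.
have -> : (fun w => Z w * U w) = (fun w =>
    Z w * Num.max (1 * U w) 0 - Z w * Num.max (-1 * U w) 0).
  apply/funext => w; rewrite -mulrBr mul1r mulN1r; congr (_ * _).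
  by case: (lerP 0 (U w)) => u0; case: (lerP (- U w) 0) => u1; lra.
have n1 : `|-1 : R| = 1 by rewrite normrN1.
rewrite meanB ?M ?subr0 ?normr1//; apply: L; rewrite ?normr1//.
Qed.

End Conditioning.

(** * Independence of a sample from the past *)

Section Independence.
Context {d d' : measure_display} {Omega : measurableType d}
  {T : measurableType d'} {R : realType} (Pr : probability Omega R).

(** Independence makes the joint law of the past and [Y] a product measure, so the mean is an
    iterated integral whose inner integral, with the past frozen, vanishes. The past is carried by
    the identity into the smaller sigma-algebra. *)
Lemma mean_independent_eq0 (S : set (set Omega)) (Y : Omega -> T)
    (f : g_sigma_algebraType S * T -> R) :
  S `<=` measurable -> measurable_fun setT Y ->
  (forall A B, <<s S >> A -> measurable B ->
    Pr (A `&` Y @^-1` B) = (Pr A * Pr (Y @^-1` B))%E) ->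
  measurable_fun setT f -> L1 Pr (fun w => f (w, Y w)) ->
  (forall w, L1 Pr (fun w' => f (w, Y w')) /\
             mean Pr (fun w' => f (w, Y w')) = 0) ->
  mean Pr (fun w => f (w, Y w)) = 0.
Proof.
move=> Sm mY ind mf Lf f0.
pose T2 : measurableType _ := g_sigma_algebraType S.
have mI := measurable_id_g Sm.
pose J w : T2 * T := (w, Y w).
have mJ : measurable_fun setT J by exact: measurable_fun_pair.
pose P1 := distribution Pr (HB.pack_for {mfun Omega >-> T2} (id : Omega -> T2)
  (isMeasurableFun.Build _ _ _ _ _ mI)).
pose P2 := distribution Pr (HB.pack_for {mfun Omega >-> T} Y
  (isMeasurableFun.Build _ _ _ _ _ mY)).
pose PJ := distribution Pr (HB.pack_for {mfun Omega >-> (T2 * T)%type} J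
  (isMeasurableFun.Build _ _ _ _ _ mJ)).
have PE A : measurable A -> (P1 \x P2)%E A = PJ A.
  by apply: product_measure_unique => B C mB mC; exact: ind.
have mEf : measurable_fun setT (EFin \o f) by exact/measurable_EFinP.
have LJ : PJ.-integrable setT (EFin \o f).
  by apply: integrable_pushforward; rewrite ?preimage_setT.
have LP : (P1 \x P2)%E.-integrable setT (EFin \o f).
  apply/integrableP; split=> //.
  rewrite (eq_measure_integral PJ) => [|A mA _]; last exact: PE.
  by case/integrableP : LJ.
apply/EFin_inj; rewrite meanE//.
transitivity (\int[PJ]_z (f z)%:E)%E.
  by rewrite [RHS]integral_pushforward// preimage_setT.
rewrite -(eq_measure_integral PJ (m1 := (P1 \x P2)%E)); last first.
  by move=> A mA _; exact: PE.
rewrite -integral12_prod_meas1//; apply: integral0_eq => w _.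
have [L m0] := f0 w.
rewrite /fubini_F [LHS]integral_pushforward//=.
  by rewrite preimage_setT -meanE// m0.
by apply/measurable_EFinP; exact: measurable_fun_pair2 mf.
Qed.

Variable f : nat -> Omega -> T.

(** Events that constrain the samples of index below [t] one by one: a generating family of the past
    that is closed under intersection, as uniqueness of measures requires. *)
Definition cylinders (t : nat) : set (set Omega) :=
  [set A | exists B : nat -> set T, (forall i, measurable (B i)) /\
     A = \bigcap_(i in [set` iota 0 t]) (f i @^-1` B i)].

Hypothesis mf : forall t, measurable_fun setT (f t).

Lemma cylinders_measurable t : cylinders t `<=` measurable.
Proof.
move=> _ [B [mB ->]]; apply: fin_bigcap_measurable => // i _.
by rewrite -[X in measurable X]setTI; exact: mf.
Qed.

Lemma cylinders_preimage s t (B : set T) : (s < t)%N -> measurable B ->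
  cylinders t (f s @^-1` B).
Proof.
move=> st mB; exists (fun i => if i == s then B else setT); split.
  by move=> i; case: ifP.
apply/seteqP; split=> [w Bw i _|w /(_ s)]/=; first by case: eqP => // ->.
by rewrite eqxx; apply; rewrite mem_iota.
Qed.

Lemma cylinders_setI t : setI_closed (cylinders t).
Proof.
move=> _ _ [B [mB ->]] [C [mC ->]]; exists (fun i => B i `&` C i); split.
  by move=> i; exact: measurableI.
rewrite -bigcapI; apply: eq_bigcapr => i _.
by rewrite preimage_setI.
Qed.

(** Both sides are finite measures in [A]; mutual independence makes them agree on cylinders, hence
    on the generated sigma-algebra. *)
Lemma independent_past t A B : mutually_independent Pr f ->
  <<s cylinders t >> A -> measurable B ->
  Pr (A `&` f t @^-1` B) = (Pr A * Pr (f t @^-1` B))%E.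
Proof.
move=> ind PA mB; have mfB : measurable (f t @^-1` B).
  by rewrite -[X in measurable X]setTI; exact: mf.
have fP0 : 0 <= fine (Pr (f t @^-1` B)) by rewrite fine_ge0.
have prE C : measurable C -> Pr C = (fine (Pr C))%:E.
  by move=> mC; rewrite fineK// fin_num_measure.
transitivity (mscale (NngNum fP0) Pr A); last first.
  by rewrite /mscale/= -prE// muleC.
apply: (@g_sigma_algebra_measure_unique _ _ _ (cylinders t) _ (fun=> setT)
  _ _ (mrestr Pr mfB)) => //.
- exact: cylinders_measurable.
- move=> _; exists (fun=> setT); split=> //.
  by apply/seteqP; split.
- by rewrite bigcup_const//; exists 0%N.
- exact: cylinders_setI.
- move=> C GC; have mC := cylinders_measurable GC.
  change (Pr (C `&` f t @^-1` B) =
    ((fine (Pr (f t @^-1` B)))%:E * Pr C)%E).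
  rewrite [LHS]prE; last exact: measurableI.
  rewrite [in RHS](prE C)// -EFinM; congr EFin.
  have [D [mD CD]] := GC.
  (* [E] extends the cylinder by the constraint [B] at index [t]; independence is then used for [t]
     and for [t.+1] samples and the two products are compared. *)
  pose E i := if i == t then B else D i.
  have mE i : measurable (E i) by rewrite /E; case: ifP.
  have := ind (iota 0 t.+1) E (iota_uniq _ _) mE.
  have := ind (iota 0 t) E (iota_uniq _ _) mE.
  have ED : \bigcap_(i in [set` iota 0 t]) (f i @^-1` E i) = C.
    rewrite CD; apply: eq_bigcapr => i /=; rewrite mem_iota /= add0n => it.
    by rewrite /E ltn_eqF.
  have -> : \bigcap_(i in [set` iota 0 t.+1]) (f i @^-1` E i) =
      C `&` f t @^-1` B.
    have memI i n : [set` iota 0 n] i = (i < n)%N :> Prop.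
      by rewrite /mkset mem_iota.
    rewrite -ED; apply/seteqP; split=> w.
      move=> H; split=> [i|]; last first.
        by have := H t; rewrite memI ltnSn /E eqxx; apply.
      by rewrite memI => it; apply: H; rewrite memI ltnW.
    move=> [H Bw] i; rewrite memI ltnS leq_eqVlt => /orP[/eqP ->|it].
      by rewrite /E eqxx.
    by apply: H; rewrite memI.
  rewrite ED => -> ->; rewrite -addn1 iotaD big_cat/= big_seq1 add0n /E eqxx.
  by rewrite mulrC.
- move=> _; rewrite (le_lt_trans (probability_le1 Pr _)) ?ltry//.
  exact: measurableI.
Qed.

End Independence.

(** * Borel measurability and finite nets *)

Section BorelMeasurability.
Context {R : realType}.

Lemma measurable_fun_open {d} {T : measurableType d} {U : ptopologicalType}
    (f : T -> borel U) :
  (forall O : set U, open O -> measurable (f @^-1` O)) -> measurable_fun setT f.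
Proof.
move=> fO; refine (@measurability _ _ T (borel U) setT f (@open U) erefl _).
move=> _ [W oW <-].
by rewrite setTI; apply: fO oW.
Qed.

(** The reals come with their own measurable structure, not [borel R]; it is generated by open
    intervals. *)
Lemma measurable_funR_open {d} {T : measurableType d} (f : T -> R) :
  (forall O : set R, open O -> measurable (f @^-1` O)) -> measurable_fun setT f.
Proof.
move=> fO; apply: (measurability _ (RGenOpens.measurableE R)).
move=> _ [_ [a [b ->]] <-]; rewrite setTI; apply: fO.
exact: interval_open.
Qed.

Lemma open_borel {U : ptopologicalType} (O : set U) :
  open O -> measurable (O : set (borel U)).
Proof. exact: sub_sigma_algebra. Qed.

Lemma measurable_comp_continuous {d} {T : measurableType d}
    {U : ptopologicalType} (v : T -> borel U) (f : U -> R) :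
  measurable_fun setT v -> continuous (f : U -> R^o) ->
  measurable_fun setT (fun t => f (v t)).
Proof.
move=> mv /continuousP cf; apply: measurable_funR_open => O oO.
rewrite (comp_preimage _ v f) -[X in measurable X]setTI.
by apply: mv => //; apply: open_borel; exact: cf.
Qed.

(** Interiors replace balls because a cover must consist of open sets. The centers lie in [X], where
    evaluation is an inner product and elements of H are continuous. *)
Lemma finite_net (p : nat) (X : set 'rV[R]_p) (e : R) : compact X -> 0 < e ->
  exists s : seq 'rV[R]_p, (forall q, q \in s -> X q) /\
    forall x, X x -> exists2 q, q \in s & interior (ball q e) x.
Proof.
rewrite compact_cover => cX e0.
have [||F FX XF] := cX _ X (fun q => interior (ball q e)).
- by move=> q _; exact: open_interior.
- by move=> x Xx; exists x => //; exact: nbhsx_ballx.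
exists (finmap.enum_fset F); split=> [q /FX|x /XF [q]]; first by rewrite inE.
by exists q.
Qed.

End BorelMeasurability.

(** * Evaluating a random function at a random point *)

Section JointMeasurability.
Context {R : realType} {p : nat} {X : set 'rV[R]_p} (H : RKHS X).
Hypothesis cX : compact X.
Context {d : measure_display} {T : measurableType d} (v : T -> borel H)
  (y : T -> borel 'rV[R]_p).
Hypotheses (mv : measurable_fun setT v) (my : measurable_fun setT y).

Lemma measurable_ipl h : measurable_fun setT (fun t => ip H (v t) h).
Proof.
exact: measurable_comp_continuous mv (@continuous_ipl _ _ _ H h).
Qed.

(* Evaluation is measurable at the finitely many centers of a net of X, and
   hval (v t) (y t) is the limit of its values at the centers closest to y t. *)
Lemma measurable_hval (D : set T) : measurable D -> (forall t, D t -> X (y t)) ->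
  measurable_fun D (fun t => hval (v t) (y t)).
Proof.
move=> mD DX.
have e0 n : 0 < n.+1%:R^-1 :> R by rewrite invr_gt0.
pose s n := projT1 (cid (finite_net cX (e0 n))).
have sP n := projT2 (cid (finite_net cX (e0 n))).
pose B n q : set 'rV[R]_p := interior (ball q n.+1%:R^-1).
(* The fold selects the first center whose ball contains [y t], a finite measurable case
   distinction; the default 0 is not reached when [y t] is in [X]. *)
pose g n r t := foldr (fun q z => if y t \in B n q then hval (v t) q else z)
  0 r.
apply: (@measurable_fun_cvg _ _ _ D (fun n t => g n (s n) t)).
  move=> n; apply: measurable_funTS.
  have : forall q, q \in s n -> X q by case: (sP n).
  elim: (s n) => [_|q r ih qX]; first exact: measurable_cst.
  apply: measurable_fun_ifT.
  - apply: (measurable_fun_bool true).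
    rewrite setTI (_ : _ @^-1` _ = y @^-1` B n q); last first.
      by apply/seteqP; split=> t /=; [exact: set_mem|exact: mem_set].
    rewrite -[X in measurable X]setTI; apply: my => //.
    by apply: open_borel; exact: open_interior.
  - rewrite (_ : (fun t => _) = fun t => ip H (v t) (ksec H q)).
      exact: measurable_ipl.
    apply/funext => t; apply: reproducing; apply: qX.
    by rewrite inE eqxx.
  - by apply: ih => q' q'r; apply: qX; rewrite inE q'r orbT.
move=> t Dt; have Xy := DX _ Dt.
have gE n : exists q, [/\ X q, B n q (y t) & g n (s n) t = hval (v t) q].
  have [sX sB] := sP n; have [q qs Bq] := sB _ Xy.
  have : exists2 q, q \in s n & B n q (y t) by exists q.
  rewrite /s in sX *; elim: (projT1 _) sX => [|a r ih] sX; first by case.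
  case=> b; rewrite inE /g/= => br Bb; case: ifPn => [ya|ya].
    by exists a; split; [apply: sX; rewrite inE eqxx|exact: set_mem|].
  apply: ih => [c cr|]; first by apply: sX; rewrite inE cr orbT.
  exists b => //; case/predU1P: br => // ba.
  by move: ya; rewrite -ba notin_setE.
have /subspace_continuousP/(_ _ Xy) := @hval_continuous _ _ _ H (v t).
move=> /cvgrPdist_lt cvg_v; apply/cvgrPdist_lt => e /cvg_v.
rewrite near_withinE => /nbhs_ballP[r /= r0 rX]; near=> n.
have [q [Xq Bq ->]] := gE n; apply: rX Xq.
apply: ball_sym; apply: le_ball (interior_subset Bq).
by apply/ltW; near: n; exact: near_infty_natSinv_lt (PosNum r0).
Unshelve. all: by end_near.
Qed.

End JointMeasurability.

(** * Extending identities from indicators to nonnegative functions *)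

Section IntegrationOperators.
Context {R : realType}.
Local Open Scope ereal_scope.

Definition nonneg_measurable {d} {T : measurableType d} (f : T -> \bar R) :=
  (forall t, 0 <= f t) /\ measurable_fun setT f.

(* The properties of integration, against a measure or a kernel, that determine
   it on nonnegative functions from its values on indicators. *)
Record integration_operator {d d'} {T : measurableType d}
    {T' : measurableType d'} (K : (T -> \bar R) -> T' -> \bar R) : Prop := {
  io_nnm : forall f, nonneg_measurable f -> nonneg_measurable (K f);
  io_le : forall f g, nonneg_measurable f -> nonneg_measurable g ->
    (forall t, f t <= g t) -> forall x, K f x <= K g x;
  io_D : forall f g, nonneg_measurable f -> nonneg_measurable g ->
    K (fun t => f t + g t) = fun x => K f x + K g x;
  io_Z : forall (r : R) f, (0 <= r)%R -> nonneg_measurable f ->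
    K (fun t => r%:E * f t) = fun x => r%:E * K f x;
  io_lim : forall f : nat -> T -> \bar R, (forall n, nonneg_measurable (f n)) ->
    (forall t, nondecreasing_seq (f ^~ t)) ->
    forall x, K (fun t => limn (f ^~ t)) x = limn (fun n => K (f n) x)
}.

(** Closure under composition is the purpose of the notion: the threefold iterated integral over
    state, action and next state becomes a single operator. *)
Lemma io_comp {d1 d2 d3} {T1 : measurableType d1} {T2 : measurableType d2}
    {T3 : measurableType d3} (K : (T1 -> \bar R) -> T2 -> \bar R)
    (L : (T2 -> \bar R) -> T3 -> \bar R) :
  integration_operator K -> integration_operator L ->
  integration_operator (fun f => L (K f)).
Proof.
move=> iK iL; split.
- by move=> f /(io_nnm iK)/(io_nnm iL).
- move=> f g nf ng fg; apply: (io_le iL); [exact: (io_nnm iK)..|].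
  exact: (io_le iK).
- by move=> f g nf ng; rewrite (io_D iK)// (io_D iL)//; exact: (io_nnm iK).
- by move=> r f r0 nf; rewrite (io_Z iK)// (io_Z iL)//; exact: (io_nnm iK).
- move=> f nf ndf x; rewrite -(io_lim iL); last 2 first.
  + by move=> n; exact: (io_nnm iK).
  + by move=> t m n mn; apply: (io_le iK) => // s; exact: ndf.
  by congr (L _ x); apply/funext => t; rewrite (io_lim iK).
Qed.

Lemma io_precomp {d d'} {T : measurableType d} {T' : measurableType d'}
  (Y : T' -> T) : measurable_fun setT Y ->
  integration_operator (fun f : T -> \bar R => f \o Y).
Proof.
move=> mY; split=> //.
- by move=> f [f0 mf]; split=> [x|]; [exact: f0|exact: measurableT_comp].
- by move=> f g _ _ fg x; exact: fg.
Qed.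

Lemma nnm_restrict {d} {T : measurableType d} (D : set T) (f : T -> \bar R) :
  measurable D -> nonneg_measurable f -> nonneg_measurable (f \_ D).
Proof.
move=> mD [f0 mf]; split=> [t|].
  by rewrite patchE; case: ifP.
by apply/(measurable_restrictT _ mD)/measurable_funTS.
Qed.

Lemma io_restrict {d} {T : measurableType d} (D : set T) : measurable D ->
  integration_operator (fun f : T -> \bar R => f \_ D).
Proof.
move=> mD; split.
- by move=> f; exact: nnm_restrict.
- by move=> f g _ _ fg x; rewrite !patchE; case: ifP.
- by move=> f g _ _; apply/funext => x; rewrite !patchE; case: ifP; rewrite ?adde0.
- by move=> r f _ _; apply/funext => x; rewrite !patchE; case: ifP; rewrite ?mule0.
- move=> f _ _ x; rewrite patchE; case: ifP => xD.
    by congr (lim (_ @ \oo)); apply/funext => n; rewrite patchE xD.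
  under [in RHS]eq_fun do rewrite patchE xD.
  by rewrite lim_cst.
Qed.

(** A measure is treated as a kernel from the one-point space, so that it composes with the other
    operators. *)
Lemma io_integral {d} {T : measurableType d} (m : {measure set T -> \bar R}) :
  integration_operator (fun (f : T -> \bar R) (_ : unit) => \int[m]_t f t).
Proof.
split.
- by move=> f [f0 mf]; split=> [_|]; [exact: integral_ge0|exact: measurable_cst].
- by move=> f g [f0 mf] [g0 mg] fg _; exact: ge0_le_integral.
- by move=> f g [f0 mf] [g0 mg]; apply/funext => _; rewrite ge0_integralD.
- by move=> r f r0 [f0 mf]; apply/funext => _; rewrite ge0_integralZl.
- move=> f nf ndf _; apply: monotone_convergence => //.
  + by move=> n; case: (nf n).
  + by move=> n t _; case: (nf n).
Qed.

Lemma io_kfcomp {d d'} {T : measurableType d} {T' : measurableType d'}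
  (k : R.-ftker T' ~> T) :
  integration_operator (fun f : T' * T -> \bar R => kfcomp k f).
Proof.
have nnm2 (f : T' * T -> \bar R) x :
    nonneg_measurable f -> nonneg_measurable (fun y => f (x, y)).
  by move=> [f0 mf]; split=> [y|]; [exact: f0|exact: measurable_fun_pair2 mf].
split.
- move=> f [f0 mf]; split=> [x|]; first exact: integral_ge0.
  exact: measurable_kfcomp.
- move=> f g /nnm2 nf /nnm2 ng fg x.
  by have [f0 mf] := nf x; have [g0 mg] := ng x; exact: ge0_le_integral.
- move=> f g /nnm2 nf /nnm2 ng; apply/funext => x.
  have [f0 mf] := nf x; have [g0 mg] := ng x.
  by rewrite /kfcomp ge0_integralD.
- move=> r f r0 /nnm2 nf; apply/funext => x; have [f0 mf] := nf x.
  by rewrite /kfcomp ge0_integralZl.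
- move=> f nf ndf x.
  apply: (@monotone_convergence _ _ _ (k x) setT _ (fun n y => f n (x, y))) => //.
  + by move=> n; case: (nnm2 _ x (nf n)).
  + by move=> n t _; case: (nnm2 _ x (nf n)).
Qed.

Import HBNNSimple.

(** Linearity extends the agreement to nonnegative simple functions, and monotone limits to all
    nonnegative measurable ones. *)
Lemma eq_integration_operator {d d'} {T : measurableType d}
    {T' : measurableType d'} (K L : (T -> \bar R) -> T' -> \bar R) x :
  integration_operator K -> integration_operator L ->
  (forall B, measurable B ->
    K (fun t => (\1_B t)%:E) x = L (fun t => (\1_B t)%:E) x) ->
  forall f, nonneg_measurable f -> K f x = L f x.
Proof.
move=> iK iL KL f [f0 mf].
have nnm_indic (B : set T) : measurable B ->
    nonneg_measurable (fun t => (\1_B t)%:E : \bar R).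
  by move=> mB; split=> [t|]; [rewrite lee_fin|exact/measurable_EFinP].
have nnmZ (r : R) (g : T -> \bar R) : (0 <= r)%R -> nonneg_measurable g ->
    nonneg_measurable (fun t => r%:E * g t).
  move=> r0 [g0 mg]; split=> [t|]; last exact: measurable_funeM.
  by rewrite mule_ge0// lee_fin.
pose u := nnsfun_approx measurableT mf.
have nnmu n : nonneg_measurable (fun t => (u n t)%:E : \bar R).
  by split=> [t|]; [rewrite lee_fin|exact/measurable_EFinP].
have fE : f = fun t => limn (fun n => (u n t)%:E).
  apply/funext => t; apply/esym/cvg_lim => //.
  by apply: cvg_nnsfun_approx => // ? _; exact: f0.
have ndu t : nondecreasing_seq (fun n => (u n t)%:E : \bar R).
  by move=> a b ab; rewrite lee_fin; exact/lefP/nd_nnsfun_approx.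
rewrite fE (io_lim iK)// (io_lim iL)//; congr (lim (_ @ \oo)).
apply/funext => n.
pose s := finmap.enum_fset (fset_set (range (u n))).
(* [Num.max r 0] equals [r] on values that are attained; it makes every coefficient nonnegative, so
   that the induction can run over an arbitrary list. *)
have -> : (fun t => (u n t)%:E) =
    (fun t => \sum_(r <- s) (Num.max r 0)%:E * (\1_(u n @^-1` [set r]) t)%:E :> \bar R).
  apply/funext => t; rewrite (fimfunE (u n)) fsbig_finite//=.
  under [in RHS]eq_bigr do rewrite -EFinM.
  rewrite sumEFin; congr EFin; apply: eq_bigr => r _; rewrite indicE.
  case: (boolP (t \in u n @^-1` [set r])) => [|_]; last by rewrite !mulr0.
  by rewrite inE /= => <-; rewrite max_l.
have nnm_sum (r : seq R) : nonneg_measurable (fun t => \sum_(i <- r)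
    (Num.max i 0)%:E * (\1_(u n @^-1` [set i]) t)%:E :> \bar R).
  split=> [t|].
    apply: sume_ge0 => i _; rewrite mule_ge0// lee_fin ?le_max ?lexx ?orbT//.
  apply: emeasurable_sum => i; apply: measurable_funeM.
  by case: (nnm_indic (u n @^-1` [set i])).
elim: s => [|r s ih].
  have e0 : (fun t : T => \sum_(i <- [::]) (Num.max i 0)%:E *
      (\1_(u n @^-1` [set i]) t)%:E :> \bar R) = fun t => 0%:E * (\1_setT t)%:E.
    by apply/funext => t; rewrite big_nil mul0e.
  by rewrite e0 (io_Z iK)// ?(io_Z iL)// ?mul0e//; exact: nnm_indic.
have eS : (fun t : T => \sum_(i <- r :: s) (Num.max i 0)%:E *
    (\1_(u n @^-1` [set i]) t)%:E :> \bar R) = fun t =>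
    (Num.max r 0)%:E * (\1_(u n @^-1` [set r]) t)%:E +
    \sum_(i <- s) (Num.max i 0)%:E * (\1_(u n @^-1` [set i]) t)%:E.
  by apply/funext => t; rewrite big_cons.
have r0 : (0 <= Num.max r 0)%R by rewrite le_max lexx orbT.
have ni := nnm_indic _ (measurable_funPTI (u n) (measurable_set1 r)).
rewrite eS (io_D iK)//; last exact: nnmZ.
rewrite (io_D iL)//; last exact: nnmZ.
by rewrite ih (io_Z iK)// (io_Z iL)// KL.
Qed.

End IntegrationOperators.

(** * The law of a sample, and integrating out the next state *)

Lemma borel_compact (R : realType) (n : nat) (X : set 'rV[R]_n) : compact X ->
  measurable (X : set (borel 'rV[R]_n)).
Proof.
move=> cX; rewrite -[X]setCK; apply: measurableC; apply: open_borel.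
by apply: closed_openC; apply: compact_closed cX; exact: norm_hausdorff.
Qed.

(** The complement of [D] is null. This reconciles the sample law, which does not restrict the next
    state, with expectations restricted to the state space. *)
Lemma measure_setI_full {d} {T : measurableType d} {R : realType}
    (m : {measure set T -> \bar R}) (D B : set T) :
  measurable D -> measurable B -> m setT = 1%E -> m D = 1%E ->
  m (B `&` D) = m B.
Proof.
move=> mD mB mT1 mD1.
have DC0 : m (~` D) = 0%E.
  have E : (m setT = m (~` D) + m D)%E.
    rewrite -setTD -[X in (_ + m X)%E](setTI D).
    exact: (measureDI m measurableT mD).
  rewrite mT1 mD1 in E.
  have := measure_ge0 m (~` D); move: E; case: (m (~` D)) => [r||]//= [].
  by move=> /esym/eqP; rewrite addrC -subr_eq0 addrAC subrr add0r => /eqP ->.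
have BD0 : m (B `\` D) = 0%E.
  apply/eqP; rewrite -measure_le0 -DC0; apply: le_measure; rewrite ?inE.
  - exact: measurableD.
  - exact: measurableC.
  - by move=> t [].
apply/esym/(etrans (measureDI m mB mD)).
by apply: etrans (add0e _); congr (_ + _)%E; exact: BD0.
Qed.

Section SampleLaw.
Context {d : measure_display} {Omega : measurableType d} {R : realType}
  {p q : nat} (M : MDP R p q) (pi : policy M) (mu : state_distribution M)
  (Pr : probability Omega R).
Context (xs : nat -> Omega -> 'rV[R]_p) (acts : nat -> Omega -> 'rV[R]_q)
  (ys : nat -> Omega -> 'rV[R]_p).
Hypothesis iid : iid_samples pi mu Pr xs acts ys.
Local Notation X := (state M).
Local Notation A := (action M).
Hypotheses (cX : compact X) (cA : compact A).
Local Notation bX := (borel 'rV[R]_p).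
Local Notation bA := (borel 'rV[R]_q).
Local Notation S := (bX * bA * bX)%type.
Local Notation sample := (sample xs acts ys).
Local Open Scope ereal_scope.

Definition domain : set S := X `*` A `*` X.

Let mX : measurable (X : set bX). Proof. exact: borel_compact. Qed.
Let mA : measurable (A : set bA). Proof. exact: borel_compact. Qed.

Lemma domain_measurable : measurable domain.
Proof. by apply: measurableX => //; exact: measurableX. Qed.

Lemma domain_sample t w : domain (sample t w).
Proof. by have [] := sample_range iid t w. Qed.

(** The three restrictions of the domains of integration move into the integrand, so that each layer
    is a kernel acting on the whole space. *)
Lemma expect_xayE (f : S -> \bar R) :
  expect_xay pi mu (fun x a y => f (x, a, y)) =
  \int[mu]_x kfcomp pi (kfcomp (trans M) (f \_ domain)) x.
Proof.
rewrite /expect_xay /expect_xa integral_mkcond; apply: eq_integral => x _.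
rewrite patchE /kfcomp; case: ifPn => xX; last first.
  rewrite integral0_eq// => a _; rewrite integral0_eq// => y _.
  rewrite patchE ifN//; apply: contra xX => /set_mem[[/= Xx _] _].
  exact/mem_set.
rewrite integral_mkcond; apply: eq_integral => a _.
rewrite patchE; case: ifPn => aA; last first.
  rewrite integral0_eq// => y _.
  rewrite patchE ifN//; apply: contra aA => /set_mem[[/= _ Aa] _].
  exact/mem_set.
rewrite integral_mkcond; apply: eq_integral => y _; rewrite !patchE.
have -> : ((x, a, y) \in domain) = (y \in X) => //.
move/set_mem in xX; move/set_mem in aA.
by apply/idP/idP => /set_mem H; apply/mem_set; [case: H|].
Qed.

Lemma expect_xay_io : integration_operator (fun (f : S -> \bar R) (_ : unit) =>
  expect_xay pi mu (fun x a y => f (x, a, y))).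
Proof.
under [X in integration_operator X]eq_fun do under eq_fun do rewrite expect_xayE.
have := io_comp (io_comp (io_comp (io_restrict domain_measurable)
  (io_kfcomp (trans M))) (io_kfcomp (pi : R.-ftker bX ~> bA))) (io_integral mu).
exact.
Qed.

(** [sample_law] is the case of indicators, and both sides are integration operators. *)
Lemma law_ge0 t (f : S -> \bar R) : nonneg_measurable f ->
  \int[Pr]_w f (sample t w) = expect_xay pi mu (fun x a y => f (x, a, y)).
Proof.
apply: (eq_integration_operator (x := tt) _ expect_xay_io
  (K := fun f _ => \int[Pr]_w f (sample t w))).
  exact: (io_comp (io_precomp (sample_measurable iid t)) (io_integral Pr)).
move=> B mB.
transitivity (Pr (sample t @^-1` B)).
  rewrite -[LHS]/(\int[Pr]_w (\1_(sample t @^-1` B) w)%:E) integral_indic ?setIT//.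
  by rewrite -[X in measurable X]setTI; exact: (sample_measurable iid t).
rewrite (sample_law iid t mB) /expect_xay /expect_xa.
apply: eq_integral => x /set_mem xX; apply: eq_integral => a /set_mem aA.
have mB' : measurable [set y : bX | B (x, a, y)].
  rewrite -[X in measurable X]setTI.
  exact: (measurable_pair1 (T2 := bX) (x, a)).
rewrite -[RHS]/(\int[trans M (x, a)]_(y in X) (\1_[set y | B (x, a, y)] y)%:E).
rewrite integral_indic// measure_setI_full//; first exact: prob_kernel.
exact: trans_state.
Qed.

(** Integrating out the next state is conditioning on state and action: [efiber] does so with
    extended values, [fiber] with real ones. *)
Definition efiber (f : S -> \bar R) (s : bX * bA) : \bar R :=
  \int[trans M s]_(y in X) f (s, y).

Definition fiber (f : S -> R) (s : bX * bA) : R :=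
  Rintegral (trans M s) X (fun y => f (s, y)).

Let xa (t : nat) (w : Omega) : bX * bA := (sample t w).1.

Let mxa t : measurable_fun setT (xa t).
Proof. exact: measurableT_comp measurable_fst (sample_measurable iid t). Qed.

Lemma efiber_nnm f : nonneg_measurable f -> nonneg_measurable (efiber f).
Proof.
pose E : set S := setT `*` X.
have mE : measurable E by exact: measurableX.
move=> nf; have := io_nnm (io_comp (io_restrict mE) (io_kfcomp (trans M))) nf.
congr nonneg_measurable; apply/funext => s.
rewrite /efiber integral_mkcond; apply: eq_integral => y _.
rewrite !patchE; have -> // : ((s, y) \in E) = (y \in X).
by apply/idP/idP => /set_mem H; apply/mem_set; [case: H|].
Qed.

(** Tower property: [efiber f] is constant in the next state, and transitions stay in the state
    space with probability 1. *)
Lemma law_efiber t f : nonneg_measurable f ->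
  \int[Pr]_w f (sample t w) = \int[Pr]_w efiber f (xa t w).
Proof.
move=> nf; rewrite law_ge0//.
have nF := io_nnm (io_precomp (@measurable_fst _ _ (bX * bA)%type bX))
  (efiber_nnm nf).
rewrite [RHS](law_ge0 t nF) /expect_xay /expect_xa.
apply: eq_integral => x /set_mem xX; apply: eq_integral => a /set_mem aA.
rewrite -[RHS]/(\int[trans M (x, a)]_(y in X) cst (efiber f (x, a)) y).
by rewrite integral_cst// trans_state// mule1.
Qed.

Let nnm_abs (f : S -> R) : measurable_fun setT f ->
  nonneg_measurable (fun z => `|f z|%:E).
Proof.
move=> mf; split=> [z|]; first by rewrite lee_fin.
by apply/measurable_EFinP; exact: measurableT_comp.
Qed.

Let nnm_pos (f : S -> R) : measurable_fun setT f ->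
  nonneg_measurable ((EFin \o f)^\+).
Proof.
move=> mf; split=> [z|]; first exact: funepos_ge0.
exact/measurable_funepos/measurable_EFinP.
Qed.

Let nnm_neg (f : S -> R) : measurable_fun setT f ->
  nonneg_measurable ((EFin \o f)^\-).
Proof.
move=> mf; split=> [z|]; first exact: funeneg_ge0.
exact/measurable_funeneg/measurable_EFinP.
Qed.

(** This holds for every fiber, integrable or not, so that [fiber] is measurable as soon as [f]
    is. *)
Lemma fiberE (f : S -> R) (s : bX * bA) : fiber f s =
  fine (efiber ((EFin \o f)^\+) s - efiber ((EFin \o f)^\-) s).
Proof.
rewrite /fiber /Rintegral integralE /efiber; congr (fine (_ - _)).
  by apply: eq_integral => y _; rewrite !funeposE.
by apply: eq_integral => y _; rewrite !funenegE.
Qed.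

Lemma fiber_measurable (f : S -> R) : measurable_fun setT f ->
  measurable_fun setT (fiber f).
Proof.
move=> mf; have -> : fiber f = fine \o (fun s =>
    efiber ((EFin \o f)^\+) s - efiber ((EFin \o f)^\-) s).
  by apply/funext => s; exact: fiberE.
apply: measurableT_comp; first exact: fine_measurable.
apply: emeasurable_funB.
- by case: (efiber_nnm (nnm_pos mf)).
- by case: (efiber_nnm (nnm_neg mf)).
Qed.

Let efiber_integrable t f : nonneg_measurable f ->
  \int[Pr]_w f (sample t w) < +oo ->
  Pr.-integrable setT (fun w => efiber f (xa t w)).
Proof.
move=> nf foo; have [e0 me] := efiber_nnm nf.
apply/integrableP; split; first exact: measurableT_comp.
by under eq_integral do rewrite gee0_abs//; rewrite -law_efiber.
Qed.

Let L1_abs t (f : S -> R) : L1 Pr (f \o sample t) ->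
  \int[Pr]_w `|f (sample t w)|%:E < +oo.
Proof. by move=> /integrableP[]. Qed.

Lemma efiber_abs_integrable t (f : S -> R) : measurable_fun setT f ->
  L1 Pr (f \o sample t) ->
  Pr.-integrable setT (fun w => efiber (fun z => `|f z|%:E) (xa t w)).
Proof. by move=> mf /L1_abs; apply: efiber_integrable; exact: nnm_abs. Qed.

Lemma ae_efiber_abs t (f : S -> R) : measurable_fun setT f -> L1 Pr (f \o sample t) ->
  {ae Pr, forall w, efiber (fun z => `|f z|%:E) (xa t w) < +oo}.
Proof.
move=> mf Lf; have := integrable_ae measurableT (efiber_abs_integrable mf Lf).
by apply: filterS => w /(_ I); rewrite fin_numElt => /andP[].
Qed.

Let fiber_section (f : S -> R) (s : bX * bA) : measurable_fun setT f ->
  measurable_fun (X : set bX) (fun y : bX => (f (s, y))%:E).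
Proof.
move=> mf; apply: measurable_funTS; apply/measurable_EFinP.
exact: measurable_fun_pair2 mf.
Qed.

Lemma fiber_integrable (f : S -> R) (s : bX * bA) : measurable_fun setT f ->
  efiber (fun z => `|f z|%:E) s < +oo ->
  (trans M s).-integrable X (EFin \o (fun y => f (s, y))).
Proof. by move=> mf foo; apply/integrableP; split; [exact: fiber_section|]. Qed.

Lemma L1_fiber t (f : S -> R) : measurable_fun setT f -> L1 Pr (f \o sample t) ->
  L1 Pr (fun w => fiber f (xa t w)).
Proof.
move=> mf Lf; apply: le_integrable (efiber_abs_integrable mf Lf) => //.
  apply/measurable_EFinP; apply: measurableT_comp (mxa t).
  exact: fiber_measurable.
move=> w _; rewrite /= [leRHS]gee0_abs; last first.
  by case: (efiber_nnm (nnm_abs mf)).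
apply: le_trans (le_abse_integral (trans M (xa t w)) mX (fiber_section (xa t w) mf)).
by rewrite /fiber /Rintegral; case: (integral _ _ _) => [r||] /=;
  rewrite ?normr0 ?lexx ?leey.
Qed.

(** The tower property is applied to the positive and the negative part; the difference of their
    fibers is finite almost surely. *)
Lemma mean_fiber t (f : S -> R) : measurable_fun setT f -> L1 Pr (f \o sample t) ->
  mean Pr (f \o sample t) = mean Pr (fun w => fiber f (xa t w)).
Proof.
move=> mf Lf; apply/EFin_inj; rewrite meanE// meanE; last exact: L1_fiber.
have pE : (EFin \o (f \o sample t))^\+ = (EFin \o f)^\+ \o sample t.
  by apply/funext => w; rewrite /= !funeposE.
have nE : (EFin \o (f \o sample t))^\- = (EFin \o f)^\- \o sample t.
  by apply/funext => w; rewrite /= !funenegE.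
have poo : \int[Pr]_w ((EFin \o f)^\+) (sample t w) < +oo.
  by have := integral_funepos_lt_pinfty measurableT Lf; rewrite pE.
have noo : \int[Pr]_w ((EFin \o f)^\-) (sample t w) < +oo.
  by have := integral_funeneg_lt_pinfty measurableT Lf; rewrite nE.
have ip := efiber_integrable (nnm_pos mf) poo.
have ineg := efiber_integrable (nnm_neg mf) noo.
rewrite [LHS](integralE _ _ (EFin \o (f \o sample t))) pE nE.
rewrite (law_efiber _ (nnm_pos mf)) (law_efiber _ (nnm_neg mf)) -integralB//.
apply: ae_eq_integral => //.
- by case/integrableP: (integrableB measurableT ip ineg).
- by case/integrableP: (L1_fiber mf Lf).
have := integrable_ae measurableT (integrableB measurableT ip ineg).
by apply: filterS => w fin _; rewrite fiberE fineK//; exact: fin.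
Qed.

Lemma fiber_mul (f : S -> R) (g : bX * bA -> R) (s : bX * bA) : measurable_fun setT f ->
  efiber (fun z => `|f z|%:E) s < +oo ->
  fiber (fun z => g z.1 * f z)%R s = (g s * fiber f s)%R.
Proof.
move=> mf foo; exact: (@RintegralZl _ _ _ (trans M s) X (fun y => f (s, y)) (g s)
  mX (fiber_integrable mf foo)).
Qed.

Lemma mean_fiber_mul t (f : S -> R) (g : bX * bA -> R) : measurable_fun setT f ->
  measurable_fun setT g -> L1 Pr (f \o sample t) ->
  L1 Pr (fun w => g (xa t w) * f (sample t w))%R ->
  L1 Pr (fun w => g (xa t w) * fiber f (xa t w))%R /\
  mean Pr (fun w => g (xa t w) * f (sample t w))%R =
  mean Pr (fun w => g (xa t w) * fiber f (xa t w))%R.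
Proof.
move=> mf mg Lf Lgf.
have mgf : measurable_fun setT (fun z : S => g z.1 * f z)%R.
  by apply: measurable_funM => //; exact: measurableT_comp mg measurable_fst.
have L := L1_fiber mgf Lgf.
have E : {ae Pr, forall w, fiber (fun z => g z.1 * f z)%R (xa t w) =
    (g (xa t w) * fiber f (xa t w))%R}.
  by have := ae_efiber_abs mf Lf; apply: filterS => w; exact: fiber_mul.
have L' : L1 Pr (fun w => g (xa t w) * fiber f (xa t w))%R.
  apply: ae_le_L1 (integrable_norm L).
    apply: measurable_funM; first exact: measurableT_comp mg (mxa t).
    exact: measurableT_comp (fiber_measurable mf) (mxa t).
  by apply: filterS E => w Ew; rewrite /= Ew.
split=> //; rewrite -(ae_eq_mean L L' E).
exact: (mean_fiber mgf Lgf).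
Qed.

(** Jensen's inequality for the square: integrate [2 c f <= f^2 + c^2] with [c] the fiber mean. If
    the second moment is infinite there is nothing to show. *)
Lemma fiber_sqr_le (f : S -> R) (s : bX * bA) : measurable_fun setT f -> X s.1 -> A s.2 ->
  ((fiber f s) ^+ 2)%:E <= efiber (fun z => (f z ^+ 2)%:E) s.
Proof.
move=> mf Xs As; set I := efiber _ _.
have tX : trans M s X = 1 by case: s Xs As {I} => x a; exact: trans_state.
have mf2 : measurable_fun setT (fun z => f z ^+ 2)%R by exact: measurable_funX.
have [Ioo|] := ltP I +oo; last by rewrite leye_eq => /eqP ->; exact: leey.
have L2 : (trans M s).-integrable X (EFin \o (fun y => f (s, y) ^+ 2)%R).
  apply/integrableP; split; first exact: (fiber_section s mf2).
  by under eq_integral do rewrite /= ger0_norm ?sqr_ge0//.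
have Lc (c : R) : (trans M s).-integrable X (EFin \o cst c).
  apply/integrableP; split; first exact/measurable_EFinP/measurable_cst.
  by rewrite /= integral_cst// tX mule1 ltry.
have LD (g h : bX -> R) : (trans M s).-integrable X (EFin \o g) ->
    (trans M s).-integrable X (EFin \o h) ->
    (trans M s).-integrable X (EFin \o (g \+ h)%R).
  by move=> Lg Lh; have := integrableD mX Lg Lh; apply: eq_integrable.
have Lf : (trans M s).-integrable X (EFin \o (fun y => f (s, y))).
  apply: le_integrable (LD _ _ (Lc 1%R) L2) => //; first exact: fiber_section.
  move=> y _; rewrite /= lee_fin [leRHS]ger0_norm ?addr_ge0 ?sqr_ge0//.
  by rewrite ler_norml; apply/andP; split; nra.
have rI : I = (\int[trans M s]_(y in X) (f (s, y) ^+ 2))%R%:E.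
  by rewrite /Rintegral fineK//; exact: integrable_fin_num.
rewrite rI lee_fin; set c := fiber f s.
have Lcf : (trans M s).-integrable X (EFin \o (fun y => 2 * c * f (s, y))%R).
  by have := integrableZl mX (2 * c)%R Lf; exact: eq_integrable.
have := @le_Rintegral _ _ _ (trans M s) X _ (fun y => f (s, y) ^+ 2 + c ^+ 2)%R
  mX Lcf (LD _ _ L2 (Lc _)).
rewrite (@RintegralZl _ _ _ (trans M s) X (fun y => f (s, y)) _ mX Lf).
rewrite (@RintegralD _ _ _ (trans M s) X _ (cst (c ^+ 2)%R) mX L2 (Lc _)).
rewrite (@Rintegral_cst _ _ _ (trans M s) X mX) tX mulr1.
have le_sum y : X y -> (2 * c * f (s, y) <= f (s, y) ^+ 2 + c ^+ 2)%R.
  by move=> _; have := sqr_ge0 (f (s, y) - c)%R; nra.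
by move=> /(_ le_sum); rewrite -/(fiber f s) -/c; nra.
Qed.

Lemma L2_fiber t (f : S -> R) : measurable_fun setT f -> L2 Pr (f \o sample t) ->
  L2 Pr (fun w => fiber f (xa t w)).
Proof.
move=> mf [_ Lf2].
have mF : measurable_fun setT (fun w => fiber f (xa t w)).
  exact: measurableT_comp (fiber_measurable mf) (mxa t).
have mf2 : measurable_fun setT (fun z => f z ^+ 2)%R by exact: measurable_funX.
split=> //; apply: le_integrable (efiber_abs_integrable mf2 Lf2) => //.
  by apply/measurable_EFinP; exact: measurable_funX.
move=> w _; rewrite /= ger0_norm ?sqr_ge0// [leRHS]gee0_abs; last first.
  by case: (efiber_nnm (nnm_abs mf2)).
have [Xx Aa _] := sample_range iid t w.
apply: le_trans (@fiber_sqr_le f (xa t w) mf Xx Aa) _; rewrite /efiber.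
by under [leRHS]eq_integral do rewrite ger0_norm ?sqr_ge0//.
Qed.

(** Signed version of [law_ge0], in the nested form in which H-valued means are tested. Each part of
    [f] is treated separately; the nested integrals recombine only outside a null set of states. *)
Lemma law_signed t (f : S -> R) : measurable_fun setT f ->
  L1 Pr (f \o sample t) ->
  expect_xay pi mu (fun x a y => (f (x, a, y))%:E) =
  \int[Pr]_w (f (sample t w))%:E.
Proof.
move=> mf Lf; rewrite (expect_xayE (EFin \o f)).
pose h : S -> \bar R := (EFin \o f) \_ domain.
pose P := kfcomp (trans M) ((EFin \o f)^\+ \_ domain).
pose N := kfcomp (trans M) ((EFin \o f)^\- \_ domain).
have nP : nonneg_measurable P.
  exact: (io_nnm (io_comp (io_restrict domain_measurable)
    (io_kfcomp (trans M))) (nnm_pos mf)).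
have nN : nonneg_measurable N.
  exact: (io_nnm (io_comp (io_restrict domain_measurable)
    (io_kfcomp (trans M))) (nnm_neg mf)).
have nQP := io_nnm (io_kfcomp (pi : R.-ftker bX ~> bA)) nP.
have nQN := io_nnm (io_kfcomp (pi : R.-ftker bX ~> bA)) nN.
have pE : (EFin \o (f \o sample t))^\+ = (EFin \o f)^\+ \o sample t.
  by apply/funext => w; rewrite /= !funeposE.
have nE : (EFin \o (f \o sample t))^\- = (EFin \o f)^\- \o sample t.
  by apply/funext => w; rewrite /= !funenegE.
have IP : \int[mu]_x kfcomp pi P x = \int[Pr]_w (EFin \o (f \o sample t))^\+ w.
  by rewrite pE [RHS](law_ge0 t (nnm_pos mf)) expect_xayE.
have IN : \int[mu]_x kfcomp pi N x = \int[Pr]_w (EFin \o (f \o sample t))^\- w.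
  by rewrite nE [RHS](law_ge0 t (nnm_neg mf)) expect_xayE.
have iP : mu.-integrable setT (kfcomp pi P).
  apply/integrableP; split; first by case: nQP.
  under eq_integral do rewrite gee0_abs ?(nQP.1)//.
  by rewrite IP; exact: integral_funepos_lt_pinfty Lf.
have iN : mu.-integrable setT (kfcomp pi N).
  apply/integrableP; split; first by case: nQN.
  under eq_integral do rewrite gee0_abs ?(nQN.1)//.
  by rewrite IN; exact: integral_funeneg_lt_pinfty Lf.
have PN : kfcomp (trans M) h = P \- N.
  apply/funext => s; rewrite /kfcomp [LHS]integralE; congr (_ - _).
    apply: eq_integral => y _; rewrite funeposE /h /patch.
    by case: ifP => _; rewrite ?funeposE//= maxxx.
  apply: eq_integral => y _; rewrite funenegE /h /patch.
  by case: ifP => _; rewrite ?funenegE//= ?oppe0 ?oppr0 maxxx.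
rewrite -/h PN [RHS]integralE -IP -IN -integralB//.
have mPN : measurable_fun setT (P \- N).
  by apply: emeasurable_funB; [case: nP|case: nN].
apply: ae_eq_integral => //; last first.
(* For almost every state both parts have a finite integral over actions, so the integral of their
   difference splits. *)
- have := integrable_ae measurableT iN; have := integrable_ae measurableT iP.
  apply: filterS2 => x /(_ I) fP /(_ I) fN _.
  rewrite /kfcomp [LHS]integralB//; apply/integrableP; split.
  + exact: measurable_fun_pair2 nP.2.
  + under eq_integral do rewrite gee0_abs ?(nP.1)//.
    by move: fP; rewrite fin_numElt => /andP[].
  + exact: measurable_fun_pair2 nN.2.
  + under eq_integral do rewrite gee0_abs ?(nN.1)//.
    by move: fN; rewrite fin_numElt => /andP[].
- by case/integrableP: (integrableB measurableT iP iN).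
have -> : kfcomp pi (P \- N) =
    kfcomp pi ((P \- N)^\+) \- kfcomp pi ((P \- N)^\-).
  apply/funext => x; rewrite /kfcomp [LHS]integralE; congr (_ - _).
    by apply: eq_integral => a _; rewrite !funeposE.
  by apply: eq_integral => a _; rewrite !funenegE.
apply: emeasurable_funB.
- apply: (io_nnm (io_kfcomp (pi : R.-ftker bX ~> bA)) _).2.
  by split=> [s|]; [exact: funepos_ge0|exact: measurable_funepos].
- apply: (io_nnm (io_kfcomp (pi : R.-ftker bX ~> bA)) _).2.
  by split=> [s|]; [exact: funeneg_ge0|exact: measurable_funeneg].
Qed.

End SampleLaw.

(** * First-order optimality condition *)

Section Minimizer.
Context {R : realType} {p q : nat} (M : MDP R p q) (H : RKHS (state M)).

(** At a minimizer, difference quotients with a positive step are nonnegative, hence so is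
    [ip H G h] for every [h]; using [- h] as well forces equality. *)
Lemma minimizer_gradient_eq0 (J : H -> R) (V G : H) :
  (forall W, J V <= J W) -> is_gradient J V G -> G = 0.
Proof.
move=> Vmin [dJ Jd].
have ge0 h : 0 <= ip H G h.
  rewrite leNgt; apply/negP => lt0.
  have dE : derive (J : H -> R^o) V h = ip H G h by rewrite deriveE// Jd.
  have : ((fun s : R => s^-1 *: (((J : H -> R^o) \o shift V) (s *: h) - J V))
      @ (0 : R)^' --> (ip H G h : R^o))%classic.
    by rewrite -dE; exact: diff_derivable.
  move=> /cvgrPdist_lt.
  move=> /(_ (- ip H G h)); rewrite oppr_gt0 => /(_ lt0).
  rewrite /dnbhs near_withinE => /nbhs_ballP[r /= r0 rP].
  have r20 : 0 < r / 2 by rewrite divr_gt0.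
  have /rP/(_ (lt0r_neq0 r20)) : ball (0 : R) r (r / 2).
    by rewrite /ball/= sub0r normrN gtr0_norm// ltr_pdivrMr// ltr_pMr// ltr1n.
  set u := _ *: _; have u0 : 0 <= u.
    by rewrite mulr_ge0// ?subr_ge0// invr_ge0 ltW.
  by rewrite ltr_norml => /andP[]; move: lt0 u0; lra.
apply: (@eq_ip _ _ _ H) => h; rewrite ip0l; apply/eqP; rewrite eq_le ge0 andbT.
by rewrite -oppr_ge0 -ipNr ge0.
Qed.

End Minimizer.

(** * Temporal differences as functions of a sample *)

Section SampleFunctions.
Context {d : measure_display} {Omega : measurableType d} {R : realType}
  {p q : nat} (M : MDP R p q) (pi : policy M) (mu : state_distribution M)
  (H : RKHS (state M)) (Pr : probability Omega R).
Context (xs : nat -> Omega -> 'rV[R]_p) (acts : nat -> Omega -> 'rV[R]_q)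
  (ys : nat -> Omega -> 'rV[R]_p).
Hypothesis iid : iid_samples pi mu Pr xs acts ys.
Hypothesis ass1 : assumption1 H.
Local Notation X := (state M).
Local Notation A := (action M).
Local Notation bX := (borel 'rV[R]_p).
Local Notation bA := (borel 'rV[R]_q).
Local Notation S := (bX * bA * bX)%type.
Local Notation sample := (sample xs acts ys).

Let cX : compact X. Proof. by case: ass1. Qed.
Let cA : compact A. Proof. by case: ass1. Qed.
Let mD := domain_measurable cX cA.

Lemma ip_kdiff (h : H) x y : X x -> X y ->
  ip H h (kdiff H x y) = discount M * hval h y - hval h x.
Proof. by move=> Xx Xy; rewrite ipBr ipZr -!reproducing. Qed.

Lemma tdB (h h' : H) x a y : X x -> X y ->
  td h x a y - td h' x a y = ip H (h - h') (kdiff H x y).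
Proof.
move=> Xx Xy; rewrite ip_kdiff// /td !(reproducing (h - h'))// !ipBl.
by rewrite -!reproducing//; ring.
Qed.

Lemma kdiff_bounded : exists B : R, forall x y, X x -> X y -> `|kdiff H x y| <= B.
Proof.
case: ass1 => _ _ [B uB].
have kB x : X x -> `|ksec H x| <= B.
  move=> Xx; apply: uB; exists x => //.
  by rewrite -hval_ksec// reproducing// ip_norm sqrtr_sqr normr_id.
exists (`|discount M| * B + B) => x y Xx Xy.
by rewrite (le_trans (ler_normB _ _))// normrZ lerD// ?ler_wpM2l// kB.
Qed.

(* Extended by 0 outside [domain], where the values are not controlled. *)
Definition tdx (h : H) : S -> R :=
  (fun z => td h z.1.1 z.1.2 z.2) \_ (domain M).

Definition kdx (h : H) : S -> R :=
  (fun z => ip H h (kdiff H z.1.1 z.2)) \_ (domain M).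

(** By the reproducing property the inner product with a kernel difference is a combination of two
    point evaluations, which are jointly measurable. *)
Lemma kdx_measurable_joint {d'} {T : measurableType d'} (v : T -> borel H)
    (s : T -> S) : measurable_fun setT v -> measurable_fun setT s ->
  measurable_fun setT (fun t => kdx (v t) (s t)).
Proof.
move=> mv ms; have msD : measurable (s @^-1` domain M).
  by rewrite -[X in measurable X]setTI; exact: ms.
have ms1 : measurable_fun setT (fun t => (s t).1.1 : bX).
  by do 2 apply: measurableT_comp => //.
have ms2 : measurable_fun setT (fun t => (s t).2 : bX) by exact: measurableT_comp.
have -> : (fun t => kdx (v t) (s t)) = (fun t =>
    discount M * hval (v t) (s t).2 - hval (v t) (s t).1.1) \_ (s @^-1` domain M).
  apply/funext => t; rewrite /kdx !patchE.
  have -> : (s t \in domain M) = (t \in s @^-1` domain M).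
    by apply/idP/idP => /set_mem ?; exact/mem_set.
  by case: ifPn => // /set_mem[[Xx _] Xy]; rewrite ip_kdiff.
apply/(measurable_restrictT _ msD); apply: measurable_funB.
  apply: measurable_funM => //.
  by apply: (measurable_hval cX mv ms2 msD) => t [].
by apply: (measurable_hval cX mv ms1 msD) => t [[]].
Qed.

Lemma kdx_measurable h : measurable_fun setT (kdx h).
Proof.
exact: (@kdx_measurable_joint _ S (cst h) id (measurable_cst _)).
Qed.

Lemma tdxE h h' z : tdx h z = tdx h' z + kdx (h - h') z.
Proof.
rewrite /tdx /kdx !patchE; case: ifPn => [/set_mem[[Xx _] Xy]|_].
  by rewrite -(tdB _ _ z.1.2)// addrC subrK.
by rewrite addr0.
Qed.

Lemma tdx_measurable h : measurable_fun setT (tdx h).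
Proof.
have m0 : measurable_fun setT (tdx 0).
  apply/(measurable_restrictT _ mD).
  apply: (@eq_measurable_fun _ _ _ _ (domain M)
    (fun z : S => reward M z.1.1 z.1.2 z.2)); last exact: reward_measurable.
  move=> z /set_mem[[Xx _] Xy].
  by rewrite /td !(reproducing (0 : H))// !ip0l mulr0 addr0 subr0.
have -> : tdx h = fun z => tdx 0 z + kdx (h - 0) z.
  by apply/funext => z; exact: tdxE.
by apply: measurable_funD => //; exact: kdx_measurable.
Qed.

Lemma tdx_sample h t w :
  tdx h (sample t w) = td h (xs t w) (acts t w) (ys t w).
Proof. by rewrite /tdx patchE mem_set//; exact: (domain_sample iid). Qed.

Lemma kdx_sample h t w :
  kdx h (sample t w) = ip H h (kdiff H (xs t w) (ys t w)).
Proof. by rewrite /kdx patchE mem_set//; exact: (domain_sample iid). Qed.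

Lemma kdx_bounded h : exists B : R, forall z, `|kdx h z| <= B.
Proof.
have [B kB] := kdiff_bounded; exists (`|h| * `|B|) => z.
rewrite /kdx patchE; case: ifPn => [/set_mem[[Xx _] Xy]|_]; last first.
  by rewrite normr0 mulr_ge0.
rewrite (le_trans (cauchy_schwarz _ _))// ler_wpM2l//.
by rewrite (le_trans (kB _ _ Xx Xy))// ler_norm.
Qed.

Lemma mean_td_fiber h x a : X x -> A a -> mean_td h x a = fiber M (tdx h) (x, a).
Proof.
move=> Xx Aa; rewrite /mean_td /fiber; apply: eq_Rintegral => y /set_mem Xy.
by rewrite /tdx patchE mem_set.
Qed.

Lemma sample_comp_measurable t (f : S -> R) : measurable_fun setT f ->
  measurable_fun setT (f \o sample t).
Proof. by move=> mf; exact: measurableT_comp mf (sample_measurable iid t). Qed.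

Lemma L1_law s t (f : S -> R) : measurable_fun setT f ->
  L1 Pr (f \o sample s) -> L1 Pr (f \o sample t).
Proof.
move=> mf /integrableP[_ foo]; apply/integrableP; split.
  by apply/measurable_EFinP; exact: sample_comp_measurable.
have nf : nonneg_measurable (fun z => `|f z|%:E).
  split=> [z|]; first by rewrite lee_fin.
  by apply/measurable_EFinP; exact: measurableT_comp.
have := law_ge0 iid cX cA t nf; rewrite -(law_ge0 iid cX cA s nf) /= => ->.
exact: foo.
Qed.

Lemma L2_law s t (f : S -> R) : measurable_fun setT f ->
  L2 Pr (f \o sample s) -> L2 Pr (f \o sample t).
Proof.
move=> mf [_ f2]; split; first exact: sample_comp_measurable.
by apply: (@L1_law s t (fun z => f z ^+ 2)) => //; exact: measurable_funX.
Qed.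

Lemma mean_law s t (f : S -> R) : measurable_fun setT f ->
  L1 Pr (f \o sample s) -> mean Pr (f \o sample t) = mean Pr (f \o sample s).
Proof.
move=> mf Lf; have Lft := L1_law t mf Lf.
apply/EFin_inj; rewrite !meanE// -[LHS](law_signed iid cX cA mf Lft).
by rewrite -[RHS](law_signed iid cX cA mf Lf).
Qed.

Lemma kdx_sample_L2 h t : L2 Pr (kdx h \o sample t).
Proof.
have [B kB] := kdx_bounded h; apply: (@bounded_L2 _ _ _ _ _ B).
  exact: sample_comp_measurable (kdx_measurable h).
by apply: aeW => w; exact: kB.
Qed.

(** Temporal differences of two functions differ by a bounded [kdx], and all samples have the same
    law; one function at one time therefore settles all. *)
Lemma tdx_sample_L2 h h' s t : L2 Pr (tdx h' \o sample s) ->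
  L2 Pr (tdx h \o sample t).
Proof.
move=> L; have := L2D (L2_law t (tdx_measurable h') L) (kdx_sample_L2 (h - h') t).
by congr L2; apply/funext => w; rewrite /= -tdxE.
Qed.

Lemma eq_expect_xay (f g : 'rV[R]_p -> 'rV[R]_q -> 'rV[R]_p -> \bar R) :
  (forall x a y, X x -> A a -> X y -> f x a y = g x a y) ->
  expect_xay pi mu f = expect_xay pi mu g.
Proof.
move=> fg; apply: eq_integral => x /set_mem Xx; apply: eq_integral => a /set_mem Aa.
by apply: eq_integral => y /set_mem Xy; exact: fg.
Qed.

Section Optimum.
Variables (lam : R) (Vstar : H).
Hypothesis Vstar_min : forall W : H,
  objective pi mu lam Vstar <= objective pi mu lam W.
Hypothesis quasi_gradient : exists m : H,
  is_hmean pi mu (fun x a y => mean_td Vstar x a *: kdiff H x y) m /\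
  is_gradient (objective pi mu (H := H) lam) Vstar (m + lam *: Vstar).
Hypothesis Vstar_L2 : forall t, L2 Pr (tdx Vstar \o sample t).

Let dsb t w := mean_td Vstar (xs t w) (acts t w).
Let fb : bX * bA -> R := @fiber R p q M (tdx Vstar).

Let dsbE t : dsb t = fun w => fb (sample t w).1.
Proof.
apply/funext => w; have [Xx Aa _] := sample_range iid t w.
exact: mean_td_fiber.
Qed.

Let mfb : measurable_fun setT fb.
Proof. exact: (fiber_measurable cX (tdx_measurable Vstar)). Qed.

Lemma mean_td_Vstar_L2 t : L2 Pr (dsb t).
Proof. by rewrite dsbE; exact: (L2_fiber iid cX cA (tdx_measurable Vstar) (Vstar_L2 t)). Qed.

Lemma mean_td_Vstar_mul t (g : bX * bA -> R) : measurable_fun setT g ->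
  L2 Pr (fun w => g (sample t w).1) ->
  mean Pr (fun w => g (sample t w).1 * tdx Vstar (sample t w)) =
  mean Pr (fun w => g (sample t w).1 * dsb t w).
Proof.
move=> mg Lg; rewrite dsbE.
have [_] := mean_fiber_mul iid cX cA (tdx_measurable Vstar) mg
  (L2_L1 (Vstar_L2 t)) (L2M Lg (Vstar_L2 t)).
exact.
Qed.

Lemma mean_td_Vstar_mean t :
  mean Pr (dsb t) = mean Pr (tdx Vstar \o sample t).
Proof.
have := @mean_td_Vstar_mul t (cst 1) (measurable_cst _) (L2_cst _ _).
rewrite /cst; under eq_fun do rewrite mul1r; move=> ->.
by under eq_fun do rewrite mul1r.
Qed.

Lemma mean_kdiff_mean_td t h :
  mean Pr (fun w => kdx h (sample t w) * dsb t w) = - (lam * ip H Vstar h).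
Proof.
have [m [[_ mE] grad]] := quasi_gradient.
have m0 := minimizer_gradient_eq0 Vstar_min grad.
have mh : ip H m h = - (lam * ip H Vstar h).
  by apply/eqP; rewrite -addr_eq0 -ipZl -ipDl m0 ip0l.
have mf : measurable_fun setT (fun z : S => kdx h z * fb z.1).
  apply: measurable_funM; first exact: kdx_measurable.
  exact: measurableT_comp mfb measurable_fst.
have L : L1 Pr (fun w => kdx h (sample t w) * dsb t w).
  exact: L2M (kdx_sample_L2 h t) (mean_td_Vstar_L2 t).
apply/EFin_inj; rewrite meanE// -mh -mE.
rewrite dsbE in L *; rewrite -[LHS](law_signed iid cX cA mf L).
apply: eq_expect_xay => x a y Xx Aa Xy.
rewrite ipZl mean_td_fiber// mulrC ipC; congr (_ * _)%:E.
by rewrite /kdx patchE mem_set.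
Qed.

End Optimum.
End SampleFunctions.

(** * The filtration of the algorithm is contained in the past of the samples *)

Section Filtration.
Context {d : measure_display} {Omega : measurableType d} {R : realType}
  {p q : nat} (M : MDP R p q) (pi : policy M) (mu : state_distribution M)
  (H : RKHS (state M)) (Pr : probability Omega R).
Context (xs : nat -> Omega -> 'rV[R]_p) (acts : nat -> Omega -> 'rV[R]_q)
  (ys : nat -> Omega -> 'rV[R]_p).
Context (V : nat -> Omega -> H) (z : nat -> Omega -> R)
  (D : nat -> Omega -> seq 'rV[R]_p) (alpha beta eps : nat -> R) (lam : R).
Hypothesis iid : iid_samples pi mu Pr xs acts ys.
Hypothesis ass1 : assumption1 H.
Hypothesis alg : pkgtd xs acts ys V z D alpha beta eps lam.
Hypothesis adapted : adapted_iterates xs acts ys V z.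
Local Notation bX := (borel 'rV[R]_p).
Local Notation bA := (borel 'rV[R]_q).
Local Notation S := (bX * bA * bX)%type.
Local Notation sample := (sample xs acts ys).
Local Notation past t := (cylinders sample t).
Local Notation past_type t := (g_sigma_algebraType (past t)).
Local Notation filtr := (filtr xs acts ys V z).
Local Notation filtr_xa := (filtr_xa xs acts ys V z).

Let ms := sample_measurable iid.

Lemma past_measurable t : past t `<=` measurable.
Proof. exact: cylinders_measurable. Qed.

Lemma past_sample s t : (s < t)%N ->
  measurable_fun setT (sample s : past_type t -> S).
Proof.
move=> st _ B mB; rewrite setTI; apply: sub_sigma_algebra.
exact: cylinders_preimage.
Qed.

Lemma past_mono s t : (s <= t)%N -> <<s past s >> `<=` <<s past t >>.
Proof.
move=> st; apply: smallest_sub; first exact: smallest_sigma_algebra.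
move=> _ [B [mB ->]].
have : measurable (\bigcap_(i in [set` iota 0 s]) (sample i @^-1` B i) :
    set (past_type t)); last by [].
apply: fin_bigcap_measurable => // i /=; rewrite mem_iota => /= it.
rewrite -[X in measurable X]setTI; apply: (past_sample (leq_trans it st)) => //.
Qed.

Lemma measurable_fun_past s t {d'} {T : measurableType d'} (f : Omega -> T) :
  (s <= t)%N -> measurable_fun setT (f : past_type s -> T) ->
  measurable_fun setT (f : past_type t -> T).
Proof.
move=> st mf _ B mB; apply: (past_mono st); exact: mf.
Qed.

Let past_xs s t : (s < t)%N -> measurable_fun setT (xs s : past_type t -> bX).
Proof.
move=> st; have := measurableT_comp (measurable_fst : measurable_fun setT
  (fst : bX * bA -> bX)) (measurableT_comp measurable_fst (past_sample st)).
exact.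
Qed.

Let past_acts s t : (s < t)%N ->
  measurable_fun setT (acts s : past_type t -> bA).
Proof.
move=> st; have := measurableT_comp (measurable_snd : measurable_fun setT
  (snd : bX * bA -> bA)) (measurableT_comp measurable_fst (past_sample st)).
exact.
Qed.

Let past_ys s t : (s < t)%N -> measurable_fun setT (ys s : past_type t -> bX).
Proof. by move=> st; exact: (measurableT_comp measurable_snd (past_sample st)). Qed.

Let past_gen_borel t {U : ptopologicalType} (f : Omega -> U) :
  measurable_fun setT (f : past_type t -> borel U) ->
  gen_by f `<=` <<s past t >>.
Proof.
move=> mf _ [W oW <-]; apply: (mf measurableT); exact: open_borel.
Qed.

Let past_gen_real t (f : Omega -> R) :
  measurable_fun setT (f : past_type t -> R) -> gen_by f `<=` <<s past t >>.
Proof.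
move=> mf _ [W oW <-]; apply: (mf measurableT); exact: open_measurable.
Qed.

Let past_borel t {U : ptopologicalType} (f : Omega -> U) :
  (forall W, open W -> <<s past t >> (f @^-1` W)) ->
  measurable_fun setT (f : past_type t -> borel U).
Proof. by move=> fW; apply: measurable_fun_open. Qed.

Lemma past_delta t : measurable_fun setT (V t : past_type t.+1 -> borel H) ->
  measurable_fun setT (delta xs acts ys V t : past_type t.+1 -> R).
Proof.
move=> mV; have -> : delta xs acts ys V t = fun w =>
    tdx (0 : H) (sample t w) + kdx (V t w) (sample t w).
  apply/funext => w.
  by rewrite -[V t w in RHS]subr0 -tdxE (tdx_sample iid).
apply: measurable_funD.
- exact: (measurableT_comp (tdx_measurable ass1 0) (past_sample (ltnSn t))).
- exact: (@kdx_measurable_joint _ _ _ M H ass1 _ (past_type t.+1) (V t)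
    (sample t) mV (past_sample (ltnSn t))).
Qed.

(** By strong induction the generators of [filtr t], of indices below [t], are determined by past
    samples. For [V t] this then follows from adaptedness, since compression is only a relation, and
    for [z t] from its recursion. *)
Lemma filtr_past t : filtr t `<=` <<s past t >> /\
  measurable_fun setT (V t : past_type t -> borel H) /\
  measurable_fun setT (z t : past_type t -> R).
Proof.
elim/ltn_ind: t => t ih.
have Ft : filtr t `<=` <<s past t >>.
  apply: smallest_sub; first exact: smallest_sigma_algebra.
  move=> B [s /= st]; have [_ [mV mz]] := ih _ st.
  have mV' := measurable_fun_past (T := borel H) (ltnW st) mV.
  have mz' := measurable_fun_past (ltnW st) mz.
  case=> [[[[|]|]|]|].
  - exact: past_gen_borel mV' B.
  - exact: past_gen_real mz' B.
  - exact: past_gen_borel (past_xs st) B.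
  - exact: past_gen_borel (past_acts st) B.
  - exact: past_gen_borel (past_ys st) B.
have mV : measurable_fun setT (V t : past_type t -> borel H).
  by apply: past_borel => W oW; apply: Ft; exact: adapted.
split=> //; split=> //; case: t ih Ft mV => [_ _ _|t ih Ft _].
  have -> : z 0 = cst 0 by apply/funext => w; exact: (z_init alg).
  exact: measurable_cst.
have [_ [mV mz]] := ih t (ltnSn t).
have -> : z t.+1 = fun w => (1 - beta t) * z t w +
    beta t * delta xs acts ys V t w.
  by apply/funext => w; exact: (z_step alg).
apply: measurable_funD; apply: measurable_funM => //.
  exact: measurable_fun_past (leqnSn t) mz.
by apply: past_delta; exact: measurable_fun_past (leqnSn t) mV.
Qed.

Lemma V_past t : measurable_fun setT (V t : past_type t -> borel H).
Proof. by case: (filtr_past t) => _ []. Qed.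

Lemma z_past t : measurable_fun setT (z t : past_type t -> R).
Proof. by case: (filtr_past t) => _ []. Qed.

Definition filtr_xa_gen t : set (set Omega) :=
  filtr t `|` gen_by (xs t) `|` gen_by (acts t).

(** The index is [t.+1] because the current state and action belong to sample [t]. *)
Lemma filtr_xa_past t : filtr_xa t `<=` <<s past t.+1 >>.
Proof.
apply: smallest_sub; first exact: smallest_sigma_algebra.
move=> B [[|]|].
- by move=> FB; apply: (past_mono (leqnSn t)); exact: (filtr_past t).1.
- exact: past_gen_borel (past_xs (ltnSn t)) B.
- exact: past_gen_borel (past_acts (ltnSn t)) B.
Qed.

Lemma filtr_xa_gen_measurable t : filtr_xa_gen t `<=` measurable.
Proof.
move=> B GB; apply: (sub_g_measurable (@past_measurable t.+1)).
by apply: filtr_xa_past; exact: sub_sigma_algebra.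
Qed.

Lemma measurable_xa_filtr_xa t : measurable_fun setT
  ((fun w => (xs t w, acts t w)) :
     g_sigma_algebraType (filtr_xa_gen t) -> bX * bA).
Proof.
apply: measurable_fun_pair; apply: measurable_fun_open => W oW.
- by apply: sub_sigma_algebra; left; right; exists W; rewrite ?setTI.
- by apply: sub_sigma_algebra; right; exists W; rewrite ?setTI.
Qed.

Lemma measurable_past t {d'} {T : measurableType d'} (f : Omega -> T) :
  measurable_fun setT (f : past_type t -> T) -> measurable_fun setT f.
Proof. by move=> mf; apply: measurable_fun_g mf; exact: past_measurable. Qed.

Lemma past_independent t A B : <<s past t >> A -> measurable B ->
  Pr (A `&` sample t @^-1` B) = (Pr A * Pr (sample t @^-1` B))%E.
Proof. by apply: independent_past => //; exact: (sample_independent iid). Qed.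

End Filtration.

(** * One step of the algorithm in norm *)

Section Step.
Context {d : measure_display} {Omega : measurableType d} {R : realType}
  {p q : nat} (M : MDP R p q)
  (H : RKHS (state M)).
Context (xs : nat -> Omega -> 'rV[R]_p) (acts : nat -> Omega -> 'rV[R]_q)
  (ys : nat -> Omega -> 'rV[R]_p).
Context (V : nat -> Omega -> H) (z : nat -> Omega -> R)
  (D : nat -> Omega -> seq 'rV[R]_p) (alpha beta eps : nat -> R) (lam : R).
Hypothesis alg : pkgtd xs acts ys V z D alpha beta eps lam.
Hypothesis eps_ge0 : forall t, 0 <= eps t.
Hypothesis alpha_neq0 : forall t, alpha t != 0.

Let Vtilde_kspan t w : kspan H (D t w) (V t w) ->
  kspan H (Dtilde xs ys D t w) (Vtilde xs ys V z alpha lam t w).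
Proof.
move=> DV; apply: kspanB.
  by apply: kspan_catl; exact: kspanZ.
apply: kspanZ; apply: kspanB; first apply: kspanZ.
all: by apply: kspan_ksec; rewrite mem_cat !inE eqxx ?orbT.
Qed.

(** This invariant makes leaving the pruning loop without a removal a projection too. *)
Let V_kspan t w : kspan H (D t w) (V t w).
Proof.
elim: t => [|t ih]; first by rewrite (V_init alg); exact: kspan0.
have [-> _] := komp_oproj (eps_ge0 t) (Vtilde_kspan ih) (V_step alg t w).
by case: (oprojP (D t.+1 w) (Vtilde xs ys V z alpha lam t w)).
Qed.

Lemma V_step_error t w :
  `|Vtilde xs ys V z alpha lam t w - V t.+1 w| <= eps t.
Proof.
by have [] := komp_oproj (eps_ge0 t) (Vtilde_kspan (V_kspan t w)) (V_step alg t w).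
Qed.

Lemma V_step_tilde_grad t w :
  alpha t *: tilde_grad xs ys V z D alpha lam t w = V t w - V t.+1 w.
Proof.
have [E _] := komp_oproj (eps_ge0 t) (Vtilde_kspan (V_kspan t w)) (V_step alg t w).
rewrite /tilde_grad scalerA mulfV// scale1r E; congr (_ - oproj _ _).
rewrite /Vtilde /hat_grad scalerDr !scalerA scalerBl scale1r opprD addrA.
by rewrite addrAC.
Qed.

(** The increment is used in two forms: explicit with a compression error in the linear term, and as
    [alpha * tilde_grad] in the quadratic one. The error costs [4 * K * eps] because [V t w - h] has
    norm at most [2 * K]. *)
Lemma sqr_norm_step t w (K : R) (h : H) : `|V t w| <= K -> `|h| <= K ->
  `|V t.+1 w - h| ^+ 2 <= `|V t w - h| ^+ 2
    - 2 * alpha t * lam * ip H (V t w - h) (V t w)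
    - 2 * alpha t * z t.+1 w * ip H (V t w - h) (kdiff H (xs t w) (ys t w))
    + 4 * K * eps t
    + alpha t ^+ 2 * `|tilde_grad xs ys V z D alpha lam t w| ^+ 2.
Proof.
move=> VK hK; set e := V t w - h.
have eK : `|e| <= 2 * K by rewrite (le_trans (ler_normB _ _))// mulr_natl lerD.
set err := V t.+1 w - Vtilde xs ys V z alpha lam t w.
have errE : `|err| <= eps t by rewrite distrC V_step_error.
set k := kdiff H _ _; set g := tilde_grad _ _ _ _ _ _ _ _ _.
have E1 : V t.+1 w - h = e + (V t.+1 w - V t w).
  by rewrite [RHS]addrC addrA subrK.
have E2 : V t.+1 w - V t w =
    err - (alpha t * lam) *: V t w - (alpha t * z t.+1 w) *: k.
  rewrite /err /Vtilde scalerBl scale1r /k.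
  move: (V t.+1 w) (V t w) ((alpha t * lam) *: _) (_ *: kdiff H _ _) => v' v x y.
  rewrite -(addrA v) -opprD -(addrA _ (- x)) -opprD opprB (addrA v').
  by rewrite [RHS]addrAC addrK.
have E3 : `|V t.+1 w - V t w| ^+ 2 = alpha t ^+ 2 * `|g| ^+ 2.
  by rewrite -distrC -V_step_tilde_grad normrZ exprMn real_normK ?num_real.
have ierr : ip H e err <= 2 * K * eps t.
  rewrite (le_trans (ler_norm _))// (le_trans (cauchy_schwarz _ _))//.
  by rewrite ler_pM.
rewrite E1 ip_normD E3 {1}E2 (ipBr e _ (_ *: k)) (ipBr e err) !ipZr; lra.
Qed.

End Step.

(** * The pointwise drift inequality *)

Section ScalarRecursion.
Context {R : realFieldType}.

(* In the application, the cofactors of [2 * a] and of [24 * a ^+ 2] have mean 0. *)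
Lemma lyapunov_ineq (a lam lam0 K eps c : R) (e2 e2' zt z' ev evs d ds db dbp dsb T : R) :
  let ek := d - ds in let zeta := zt - c in
  0 < a -> a <= 4^-1 -> 0 < lam0 -> lam0 < 1 -> lam0 <= lam ->
  0 <= e2 -> ev = e2 + evs -> z' = zt + a * (d - zt) ->
  e2' <= e2 - 2 * a * lam * ev - 2 * a * z' * ek + 4 * K * eps + T ->
  e2' + (z' - c) ^+ 2 <= (1 - a * lam0) * (e2 + zeta ^+ 2)
    + 2 * a * (zeta * (ds - c) - (lam * evs + ek * dsb) + (d - db) * (dsb - c)
               + dbp * (dsb - c) - (ds * (dsb - c) - (dsb - c) ^+ 2))
    + 24 * a ^+ 2 * ((dbp - c) * (ds - c))
    + a / 2 * (db - dbp) ^+ 2 + T + 4 * K * eps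
    + a ^+ 2 * (48 * (d - db) ^+ 2 + 48 * (db - dbp) ^+ 2 + 37 * ek ^+ 2).
Proof.
move=> ek zeta a0 a4 l0 l1 ll e20 -> -> step.
set N6 := (dbp - c) * (ds - c).
(* Instead of a variance of [ds], the bound uses [(dbp - c)^2 <= (dbp - ds)^2 + 2 N6], where [dbp]
   comes from the previous step and [N6] has mean 0. Two three-term splittings give 3 + 9, 3 + 9, 9
   and 6. *)
have dc : (d - c) ^+ 2 <= 12 * (d - db) ^+ 2 + 12 * (db - dbp) ^+ 2
    + 9 * ek ^+ 2 + 6 * N6.
  have x3 : (dbp - c) ^+ 2 <= (dbp - ds) ^+ 2 + 2 * N6.
    by rewrite /N6; have := sqr_ge0 (ds - c); nra.
  have sum3 (x y w : R) : (x + y + w) ^+ 2 <= 3 * (x ^+ 2 + y ^+ 2 + w ^+ 2).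
    have := sqr_ge0 (x - y); have := sqr_ge0 (x - w); have := sqr_ge0 (y - w); nra.
  have s1 := sum3 (d - db) (db - dbp) (dbp - c).
  have s2 := sum3 (dbp - db) (db - d) (d - ds).
  have -> : (d - c) = (d - db + (db - dbp) + (dbp - c)) by ring.
  have E : dbp - ds = dbp - db + (db - d) + (d - ds) by ring.
  rewrite E in x3.
  have n1 : (dbp - db) ^+ 2 = (db - dbp) ^+ 2 by rewrite -sqrrN opprB.
  have n2 : (db - d) ^+ 2 = (d - db) ^+ 2 by rewrite -sqrrN opprB.
  rewrite n1 n2 in s2; rewrite /ek; lra.
(* The factor 4, together with the extra [ek ^+ 2], turns these constants into 48, 48, 37 and 24. *)
have dz : (d - zt) ^+ 2 - 2 * ek * (d - zt) <= 4 * (d - c) ^+ 2 + 4 * zeta ^+ 2 + ek ^+ 2.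
  have -> : d - zt = (d - c) - zeta by rewrite /zeta; ring.
  have := sqr_ge0 (ek + (d - c - zeta)); have := sqr_ge0 (d - c + zeta); nra.
have a2dz := ler_wpM2l (sqr_ge0 a) dz.
have a2dc := ler_wpM2l (sqr_ge0 a) dc.
(* Of the available [- 2 a zeta^2], one half pays this second-order term, which requires
   [a <= 4^-1], and the other half the contraction in [az]. *)
have a4z : 4 * a ^+ 2 * zeta ^+ 2 <= a * zeta ^+ 2.
  apply: ler_wpM2r; first exact: sqr_ge0.
  nra.
have az : a * lam0 * zeta ^+ 2 <= a * zeta ^+ 2.
  by apply: ler_wpM2r; [exact: sqr_ge0|nra].
have ae : a * lam0 * e2 <= 2 * a * lam * e2.
  by apply: ler_wpM2r => //; nra.
(* Young's inequality, weighted so that the square of [dsb - c] is exactly the negative one left by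
   [S_eq]. *)
have cross : 2 * a * ((db - dbp) * (dsb - c)) <=
    2 * a * (dsb - c) ^+ 2 + a / 2 * (db - dbp) ^+ 2.
  by have := mulr_ge0 (ltW a0) (sqr_ge0 (2 * (dsb - c) - (db - dbp))); nra.
have key : (zt + a * (d - zt) - c) ^+ 2 =
    zeta ^+ 2 + 2 * a * zeta * (d - zt) + a ^+ 2 * (d - zt) ^+ 2.
  by rewrite /zeta; ring.
rewrite key.
(* The products [ek * zeta] cancel, leaving [- ek * c]; it is rewritten as
   [- ek * dsb + ek * (dsb - c)], and the last product is split through [db] and [dbp]. *)
have S_eq : - (lam * (e2 + evs)) - ek * zt + zeta * (d - zt) =
    - zeta ^+ 2 - lam * e2
    + (zeta * (ds - c) - (lam * evs + ek * dsb) + (d - db) * (dsb - c)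
               + dbp * (dsb - c) - (ds * (dsb - c) - (dsb - c) ^+ 2))
    + (db - dbp) * (dsb - c) - (dsb - c) ^+ 2.
  by rewrite /zeta /ek; ring.
have S_eq2 := congr1 (fun x => 2 * a * x) S_eq.
nra.
Qed.

End ScalarRecursion.

(** * Drift of the Lyapunov function in mean *)

Section Lyapunov.
Context {d : measure_display} {Omega : measurableType d} {R : realType}
  {p q : nat} (M : MDP R p q) (pi : policy M) (mu : state_distribution M)
  (H : RKHS (state M)) (Pr : probability Omega R).
Context (xs : nat -> Omega -> 'rV[R]_p) (acts : nat -> Omega -> 'rV[R]_q)
  (ys : nat -> Omega -> 'rV[R]_p).
Context (V : nat -> Omega -> H) (z : nat -> Omega -> R)
  (D : nat -> Omega -> seq 'rV[R]_p).
Context (a ep lam lam0 K G_V sigma_V L_V sigma_delta G_delta : R) (Vstar : H).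
Hypotheses (a_gt0 : 0 < a) (a_le : a <= 4^-1) (ep_ge0 : 0 <= ep) (K_gt0 : 0 < K).
Hypotheses (lam0_gt0 : 0 < lam0) (lam0_lt1 : lam0 < 1) (lam0_le : lam0 <= lam).
Hypothesis iid : iid_samples pi mu Pr xs acts ys.
Hypothesis alg : pkgtd xs acts ys V z D (fun=> a) (fun=> a) (fun=> ep) lam.
Hypothesis adapted : adapted_iterates xs acts ys V z.
Hypothesis Vstar_min : forall W : H,
  objective pi mu lam Vstar <= objective pi mu lam W.
Hypothesis ass1 : assumption1 H.
Hypothesis ass2 : assumption2 Pr xs acts ys V z sigma_delta G_delta.
Hypothesis ass3 :
  assumption3 pi mu Pr xs acts ys V z D (fun=> a) lam G_V sigma_V L_V.
Hypothesis bounded : norm_bound Pr V Vstar K.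
Local Notation bX := (borel 'rV[R]_p).
Local Notation bA := (borel 'rV[R]_q).
Local Notation S := (bX * bA * bX)%type.
Local Notation sample := (sample xs acts ys).
Local Notation past t := (cylinders sample t).
Local Notation past_type t := (g_sigma_algebraType (past t)).
Local Notation delta := (delta xs acts ys V).
Local Notation mean_delta := (mean_delta xs acts V).
Local Notation mean := (mean Pr).
Local Notation L1 := (L1 Pr).
Local Notation L2 := (L2 Pr).

(** Testing the conditional expectation on the whole space turns the almost sure bound into a bound
    of the mean. *)
Lemma cond_exp_le_mean (G : set (set Omega)) (Z : Omega -> R) c :
  cond_exp_le Pr <<s G >> Z c -> L1 Z /\ mean Z <= c.
Proof.
move=> [W [[LZ LW _ ZW] Wc]]; split=> //.
have /ZW E : <<s G >> setT by exact: (measurableT : measurable [set: g_sigma_algebraType G]).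
have -> : mean Z = mean W by apply/EFin_inj; rewrite !meanE.
rewrite -(mean_cst Pr c); apply: ae_le_mean => //; exact: L1_cst.
Qed.

Let e t w := V t w - Vstar.
Let ek t w := kdx (e t w) (sample t w).
Let ds t := tdx Vstar \o sample t.
Let dsb t w := mean_td Vstar (xs t w) (acts t w).
Let c := mean (ds 0).

Let e_bound : {ae Pr, forall w, forall t, `|e t w| <= 2 * K}.
Proof.
have [VK sK] := bounded; apply: filterS VK => w VK t.
by rewrite (le_trans (ler_normB _ _))// mulr_natl lerD.
Qed.

Let e_past t : measurable_fun setT (e t : past_type t -> borel H).
Proof.
have mV : measurable_fun setT (V t : past_type t -> borel H).
  exact: (V_past iid ass1 alg adapted).
apply: measurable_fun_open => W oW.
have oW' : open ((fun h : H => h - Vstar) @^-1` W).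
  apply: open_comp => // h _; apply: continuousB; [exact: cvg_id|exact: cvg_cst].
have := mV measurableT _ (open_borel oW').
by rewrite setTI.
Qed.

Let e_meas t : measurable_fun setT (e t : Omega -> borel H).
Proof. apply: (measurable_past iid (t := t) (T := borel H)); exact: e_past. Qed.

Let deltaE t w : delta t w = ds t w + ek t w.
Proof. by rewrite /ds /ek /= /e -tdxE (tdx_sample iid). Qed.

Let delta_sub t w : delta t w - ds t w = ip H (e t w) (kdiff H (xs t w) (ys t w)).
Proof. by rewrite deltaE addrAC subrr add0r /ek (kdx_sample iid). Qed.

Let ek_L2 t : L2 (ek t).
Proof.
have [B kB] := kdiff_bounded ass1; apply: (@bounded_L2 _ _ _ _ _ (2 * K * `|B|)).
  exact: (kdx_measurable_joint ass1 (e_meas t) (sample_measurable iid t)).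
apply: filterS e_bound => w eK; rewrite /ek (kdx_sample iid).
have [Xx _ Xy] := sample_range iid t w.
rewrite (le_trans (cauchy_schwarz _ _))// ler_pM//.
by rewrite (le_trans (kB _ _ Xx Xy))// ler_norm.
Qed.

(** The second moment of the reward is read off from [z 1]: as [V 0] and [z 0] vanish, [z 1] is [a]
    times the temporal difference of the zero function. *)
Let ds_L2 t : L2 (ds t).
Proof.
have [Lz _] := cond_exp_le_mean (z_second_moment ass2 0).
have mz : measurable_fun setT (z 1).
  exact: (measurable_past iid (z_past iid ass1 alg adapted (t := 1))).
have L0 : L2 (tdx (0 : H) \o sample 0).
  have -> : tdx (0 : H) \o sample 0 = fun w => a^-1 * z 1 w.
    apply/funext => w; rewrite (z_step alg) (z_init alg) mulr0 add0r mulKf ?gt_eqF//.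
    by rewrite /= (tdx_sample iid) /Defs.delta (V_init alg).
  exact: L2Z.
exact: (tdx_sample_L2 iid ass1 Vstar t L0).
Qed.

Let delta_L2 t : L2 (delta t).
Proof.
by rewrite (funext (deltaE t)); exact: L2D.
Qed.

Let delta_mean_L2 t : L2 (fun w => delta t w - mean_delta t w).
Proof.
have [Ld Lm _ _] := td_unbiased ass2 t.
split; first exact: L1_measurable (L1B Ld Lm).
by have [] := cond_exp_le_mean (td_variance ass2 t).
Qed.

Let mean_delta_L2 t : L2 (mean_delta t).
Proof.
have -> : mean_delta t = fun w => delta t w - (delta t w - mean_delta t w).
  by apply/funext => w; rewrite opprB addrC subrK.
exact: L2B.
Qed.

Let z_L2 t : L2 (z t).
Proof.
elim: t => [|t ih].
  have -> : z 0 = cst 0 by apply/funext => w; exact: (z_init alg).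
  exact: L2_cst.
have -> : z t.+1 = fun w => (1 - a) * z t w + a * delta t w.
  by apply/funext => w; exact: (z_step alg).
by apply: L2D; exact: L2Z.
Qed.

Let dsb_L2 t : L2 (dsb t).
Proof. exact: (mean_td_Vstar_L2 iid ass1 ds_L2). Qed.

Let ds_mean t : mean (ds t) = c.
Proof. exact: (mean_law iid ass1 t (tdx_measurable ass1 Vstar) (L2_L1 (ds_L2 0))). Qed.

Let dsb_mean t : mean (dsb t) = c.
Proof. by rewrite (mean_td_Vstar_mean iid ass1 ds_L2) -(ds_mean t). Qed.

Let mean_past_eq0 t (f : past_type t * S -> R) : measurable_fun setT f ->
  L1 (fun w => f (w, sample t w)) ->
  (forall w, L1 (fun w' => f (w, sample t w')) /\
             mean (fun w' => f (w, sample t w')) = 0) ->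
  mean (fun w => f (w, sample t w)) = 0.
Proof.
apply: mean_independent_eq0.
- exact: (past_measurable iid).
- exact: (sample_measurable iid).
- by move=> A B; exact: (past_independent iid).
Qed.

Let mean_past_mul_eq0 t (u : Omega -> R) (g : S -> R) :
  measurable_fun setT (u : past_type t -> R) -> L2 u ->
  measurable_fun setT g -> L2 (g \o sample t) -> mean (g \o sample t) = 0 ->
  mean (fun w => u w * g (sample t w)) = 0.
Proof.
move=> mu' Lu mg Lg g0.
apply: (@mean_past_eq0 t (fun x => u x.1 * g x.2)).
- apply: measurable_funM; first exact: (measurableT_comp mu' measurable_fst).
  exact: (measurableT_comp mg measurable_snd).
- exact: L2M.
- move=> w; split; first exact: (L1Z (u w) (L2_L1 Lg)).
  by have := meanZ (u w) (L2_L1 Lg); rewrite g0 mulr0.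
Qed.

Let fb : bX * bA -> R := @fiber R p q M (tdx Vstar).

Let dsbE t w : dsb t w = fb (sample t w).1.
Proof.
have [Xx Aa _] := sample_range iid t w.
exact: (mean_td_fiber Vstar Xx Aa).
Qed.

Let mfb : measurable_fun setT fb.
Proof.
by apply: fiber_measurable; [case: ass1|exact: (tdx_measurable ass1)].
Qed.

Let mfb1 : measurable_fun setT (fun s : S => fb s.1 - c).
Proof.
by apply: measurable_funB => //; exact: (measurableT_comp mfb measurable_fst).
Qed.

Let mtdx : measurable_fun setT (fun s : S => tdx Vstar s - c).
Proof. by apply: measurable_funB => //; exact: (tdx_measurable ass1). Qed.

Let ds_c_mean t : mean (fun w => ds t w - c) = 0.
Proof.
have := meanB (L2_L1 (ds_L2 t)) (L1_cst Pr c).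
by rewrite ds_mean mean_cst subrr.
Qed.

Let dsb_c_mean t : mean (fun w => dsb t w - c) = 0.
Proof.
have := meanB (L2_L1 (dsb_L2 t)) (L1_cst Pr c).
by rewrite dsb_mean mean_cst subrr.
Qed.

Let z_past_c t : measurable_fun setT (fun w : past_type t => z t w - c).
Proof. by apply: measurable_funB => //; exact: (z_past iid ass1 alg adapted). Qed.

Let N1_mean t : mean (fun w => (z t w - c) * (ds t w - c)) = 0.
Proof.
apply: (@mean_past_mul_eq0 t (fun w => z t w - c) (fun s => tdx Vstar s - c)
  (@z_past_c t) _ mtdx).
- by apply: L2B => //; exact: L2_cst.
- by apply: L2B; [exact: ds_L2|exact: L2_cst].
- exact: ds_c_mean.
Qed.

(** With the past frozen, [e t] is a fixed element of H, and the optimality condition tested against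
    it cancels the regularization term. *)
Let N2_mean t :
  mean (fun w => lam * ip H (e t w) Vstar + ek t w * dsb t w) = 0.
Proof.
pose f (x : past_type t * S) := lam * ip H (e t x.1) Vstar +
  kdx (e t x.1) x.2 * fb x.2.1.
have -> : (fun w => lam * ip H (e t w) Vstar + ek t w * dsb t w) =
    (fun w => f (w, sample t w)).
  by apply/funext => w; rewrite /f dsbE.
have me : measurable_fun setT
    ((fun x => e t x.1) : past_type t * S -> borel H).
  exact: (measurableT_comp (@e_past t) measurable_fst).
have Lip : L1 (fun w => lam * ip H (e t w) Vstar).
  apply: L1Z; apply: (@bounded_L1 _ _ _ _ _ (2 * K * K)).
    exact: measurable_ipl (e_meas t) Vstar.
  apply: filterS e_bound => w eK; rewrite (le_trans (cauchy_schwarz _ _))//.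
  by rewrite ler_pM//; case: bounded.
apply: mean_past_eq0.
- apply: measurable_funD.
    by apply: measurable_funM => //; exact: (measurable_ipl me Vstar).
  apply: measurable_funM.
    by apply: (kdx_measurable_joint ass1 me); exact: measurable_snd.
  exact: (measurableT_comp mfb (measurableT_comp measurable_fst measurable_snd)).
- apply: L1D => //=; have := L2M (ek_L2 t) (dsb_L2 t).
  by congr (integrable _ _ _); apply/funext => w /=; rewrite dsbE.
- move=> w; have LM := L2M (kdx_sample_L2 iid ass1 (e t w) t) (dsb_L2 t).
  have fE : (fun w' => f (w, sample t w')) = fun w' =>
      lam * ip H (e t w) Vstar + (kdx (e t w) \o sample t) w' * dsb t w'.
    by apply/funext => w'; rewrite /f dsbE.
  rewrite fE; split; first by apply: L1D LM; exact: L1_cst.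
  rewrite (meanD (L1_cst Pr _) LM) mean_cst.
  rewrite (mean_kdiff_mean_td iid ass1 Vstar_min (quasi_gradient_unbiased ass3 _) ds_L2).
  by rewrite (ipC (e t w)) subrr.
Qed.

(** [dsb t] depends on the current state and action only, so it is known in [filtr_xa], where the
    temporal difference error has conditional mean 0. *)
Let N3_mean t :
  mean (fun w => (delta t w - mean_delta t w) * (dsb t w - c)) = 0.
Proof.
have [Ld Lm mm ZW] := td_unbiased ass2 t.
apply: (@mean_mul_eq0 _ _ _ Pr (filtr_xa_gen xs acts ys V z t)).
- exact: (filtr_xa_gen_measurable iid ass1 alg adapted).
- exact: L1B.
- move=> B GB; have mB : measurable B.
    by apply: sub_g_measurable GB; exact: (filtr_xa_gen_measurable iid ass1 alg adapted).
  have LBd := integrableS measurableT mB (@subsetT _ _) Ld.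
  have LBm := integrableS measurableT mB (@subsetT _ _) Lm.
  under eq_integral do rewrite EFinB.
  rewrite integralB_EFin// [W in (W - _)%E]ZW// subee//.
  exact: integrable_fin_num.
- under eq_fun do rewrite dsbE.
  apply: measurable_funB => //.
  exact: (measurableT_comp mfb (@measurable_xa_filtr_xa _ _ _ _ _ _ _ xs acts ys V z t)).
- by apply: L2M => //; apply: L2B => //; exact: L2_cst.
Qed.

(** Being a version of a conditional expectation given [filtr_xa t], [mean_delta t] is past at time
    [t.+1]; this decorrelates it from the next sample in [N4_mean] and [N6_mean]. *)
Let mean_delta_past t :
  measurable_fun setT (mean_delta t : past_type t.+1 -> R).
Proof.
have [_ _ mm _] := td_unbiased ass2 t.
apply: measurable_funR_open => W oW.
by apply: (filtr_xa_past iid ass1 alg adapted); exact: mm.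
Qed.

Let N4_mean t : mean (fun w => mean_delta t w * (dsb t.+1 w - c)) = 0.
Proof.
under eq_fun do rewrite dsbE.
apply: (@mean_past_mul_eq0 t.+1 (mean_delta t) (fun s => fb s.1 - c)
  (@mean_delta_past t) _ mfb1) => //.
- have -> : (fun s : S => fb s.1 - c) \o sample t.+1 = fun w => dsb t.+1 w - c.
    by apply/funext => w; rewrite dsbE.
  by apply: L2B => //; exact: L2_cst.
- by rewrite -(dsb_c_mean t.+1); congr mean; apply/funext => w; rewrite /= dsbE.
Qed.

(** Given state and action, [ds] averages to [dsb]; the difference that remains, [c * (dsb - c)],
    has mean 0. *)
Let N5_mean t :
  mean (fun w => ds t w * (dsb t w - c) - (dsb t w - c) ^+ 2) = 0.
Proof.
have Lc : L2 (fun w => dsb t w - c) by apply: L2B => //; exact: L2_cst.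
have -> : (fun w => ds t w * (dsb t w - c) - (dsb t w - c) ^+ 2) = (fun w =>
    (dsb t w - c) * ds t w - ((dsb t w - c) * dsb t w - c * (dsb t w - c))).
  by apply/funext => w; ring.
have L1a := L2M Lc (ds_L2 t); have L1b := L2M Lc (dsb_L2 t).
have L1c := L1Z c (L2_L1 Lc).
rewrite meanB//; last exact: L1B.
rewrite (meanB L1b L1c) (meanZ _ (L2_L1 Lc)) dsb_c_mean mulr0 subr0.
have E : (fun w => dsb t w - c) = (fun w => fb (sample t w).1 - c).
  by apply/funext => w; rewrite dsbE.
have := mean_td_Vstar_mul (g := fun s => fb s - c) iid ass1 ds_L2.
rewrite -/fb => /(_ t) H5.
have mg : measurable_fun setT (fun s => fb s - c) by exact: measurable_funB.
have Lg : L2 (fun w => fb (sample t w).1 - c) by rewrite -E.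
have {}H5 := H5 mg Lg.
apply/eqP; rewrite subr_eq0; apply/eqP.
transitivity (mean (fun w => (fb (sample t w).1 - c) * tdx Vstar (sample t w))).
  by congr mean; apply/funext => w; rewrite dsbE.
by rewrite H5; congr mean; apply/funext => w; rewrite -/(dsb t w) dsbE.
Qed.

Let N6_mean t : mean (fun w => (mean_delta t w - c) * (ds t.+1 w - c)) = 0.
Proof.
apply: (@mean_past_mul_eq0 t.+1 (fun w => mean_delta t w - c)
  (fun s => tdx Vstar s - c) _ _ mtdx).
- by apply: measurable_funB => //; exact: mean_delta_past.
- by apply: L2B => //; exact: L2_cst.
- by apply: L2B; [exact: ds_L2|exact: L2_cst].
- exact: ds_c_mean.
Qed.

(** Integrability is bundled with the bound so that estimates of means add and scale without side
    conditions. *)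
Let mean_le (f : Omega -> R) m := L1 f /\ mean f <= m.

Let mean_leD f g m n : mean_le f m -> mean_le g n ->
  mean_le (fun w => f w + g w) (m + n).
Proof. by move=> [Lf fm] [Lg gn]; split; [exact: L1D|rewrite meanD// lerD]. Qed.

Let mean_leZ k f m : 0 <= k -> mean_le f m -> mean_le (fun w => k * f w) (k * m).
Proof. by move=> k0 [Lf fm]; split; [exact: L1Z|rewrite meanZ// ler_wpM2l]. Qed.

Let mean_le_cst k : mean_le (fun=> k) k.
Proof. by split; [exact: (L1_cst Pr k)|rewrite (mean_cst Pr k)]. Qed.

Let mean_le_ae (f g : Omega -> R) m : measurable_fun setT f ->
  {ae Pr, forall w, 0 <= f w <= g w} -> mean_le g m -> mean_le f m.
Proof.
move=> mf fg [Lg gm]; have Lf : L1 f.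
  apply: ae_le_L1 mf _ Lg; apply: filterS fg => w /andP[f0 fg].
  by rewrite ger0_norm.
split=> //; apply: le_trans gm; apply: ae_le_mean => //.
by apply: filterS fg => w /andP[].
Qed.

Let tg := tilde_grad xs ys V z D (fun=> a) lam.

Let tg_mean t : mean_le (fun w => `|tg t w| ^+ 2) (sigma_V ^+ 2).
Proof. exact: cond_exp_le_mean (grad_second_moment ass3 t). Qed.

Let td_error_mean t :
  mean_le (fun w => (delta t w - mean_delta t w) ^+ 2) (sigma_delta ^+ 2).
Proof. exact: cond_exp_le_mean (td_variance ass2 t). Qed.

(** Cauchy-Schwarz with [|e t| <= 2 * K] reduces this to the second moment of the kernel
    difference. *)
Let ek_mean t : mean_le (fun w => ek t w ^+ 2) ((2 * K) ^+ 2 * G_V ^+ 2).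
Proof.
apply: mean_le_ae (mean_leZ (sqr_ge0 (2 * K))
  (cond_exp_le_mean (kdiff_second_moment ass3 t))).
  by apply: measurable_funX; case: (ek_L2 t).
apply: filterS e_bound => w eK; rewrite sqr_ge0 -exprMn /=.
rewrite /ek (kdx_sample iid) -real_normK ?num_real//.
have le2 : `|ip H (e t w) (kdiff H (xs t w) (ys t w))| <=
    2 * K * `|kdiff H (xs t w) (ys t w)|.
  by rewrite (le_trans (cauchy_schwarz _ _))// ler_wpM2r.
by rewrite ler_sqr ?nnegrE// (le_trans _ le2).
Qed.

Let drift_mean t :
  mean_le (fun w => (mean_delta t.+1 w - mean_delta t w) ^+ 2)
    (L_V ^+ 2 * (a ^+ 2 * sigma_V ^+ 2)).
Proof.
apply: mean_le_ae (mean_leZ (sqr_ge0 L_V) (mean_leZ (sqr_ge0 a) (tg_mean t))).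
  by apply: measurable_funX; apply: measurable_funB;
    [case: (mean_delta_L2 t.+1)|case: (mean_delta_L2 t)].
apply: filterS (mean_delta_lipschitz ass3 t) => w lip; rewrite sqr_ge0 /=.
have -> : a ^+ 2 * `|tg t w| ^+ 2 = `|V t.+1 w - V t w| ^+ 2.
  have step := V_step_tilde_grad alg (fun=> ep_ge0) (fun=> lt0r_neq0 a_gt0) t w.
  rewrite [in RHS]distrC -step [in RHS]normrZ [in RHS]exprMn.
  by rewrite [in RHS]real_normK ?num_real.
rewrite -exprMn -[leLHS]real_normK ?num_real//.
by rewrite ler_sqr ?nnegrE// (le_trans _ lip).
Qed.

Let lyapunov t w := `|e t w| ^+ 2 + (z t w - c) ^+ 2.

Let e2_measurable t : measurable_fun setT (fun w => `|e t w| ^+ 2).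
Proof.
apply: measurable_funX.
exact: (measurable_comp_continuous (@e_meas t) (@norm_continuous _ H)).
Qed.

Let e2_L1 t : L1 (fun w => `|e t w| ^+ 2).
Proof.
apply: (@bounded_L1 _ _ _ _ _ ((2 * K) ^+ 2)) => //.
apply: filterS e_bound => w eK; rewrite ger0_norm ?sqr_ge0//.
by rewrite ler_sqr ?nnegrE// (le_trans _ (eK t)).
Qed.

Let z2_L1 t : L1 (fun w => (z t w - c) ^+ 2).
Proof. by have [] : L2 (fun w => z t w - c) by apply: L2B => //; exact: L2_cst. Qed.

Let lyapunov_L1 t : L1 (lyapunov t).
Proof. exact: L1D. Qed.

Let noise t w :=
  (z t.+1 w - c) * (ds t.+1 w - c)
  - (lam * ip H (e t.+1 w) Vstar + ek t.+1 w * dsb t.+1 w)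
  + (delta t.+1 w - mean_delta t.+1 w) * (dsb t.+1 w - c)
  + mean_delta t w * (dsb t.+1 w - c)
  - (ds t.+1 w * (dsb t.+1 w - c) - (dsb t.+1 w - c) ^+ 2).

Let noise_mean t : mean_le (noise t) 0.
Proof.
have Lz : L2 (fun w => z t.+1 w - c) by apply: L2B => //; exact: L2_cst.
have Lds : L2 (fun w => ds t.+1 w - c) by apply: L2B; [exact: ds_L2|exact: L2_cst].
have Ldsb : L2 (fun w => dsb t.+1 w - c) by apply: L2B => //; exact: L2_cst.
have M1 := L2M Lz Lds.
have M2 : L1 (fun w => lam * ip H (e t.+1 w) Vstar + ek t.+1 w * dsb t.+1 w).
  apply: L1D; last exact: L2M.
  apply: L1Z; apply: (@bounded_L1 _ _ _ _ _ (2 * K * K)).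
    exact: (measurable_ipl (@e_meas t.+1) Vstar).
  apply: filterS e_bound => w eK; rewrite (le_trans (cauchy_schwarz _ _))//.
  by rewrite ler_pM//; case: bounded.
have M3 := L2M (delta_mean_L2 t.+1) Ldsb.
have M4 := L2M (mean_delta_L2 t) Ldsb.
have M5 := L1B (L2M (ds_L2 t.+1) Ldsb) Ldsb.2.
have M12 := L1B M1 M2; have M13 := L1D M12 M3; have M14 := L1D M13 M4.
split; first exact: L1B.
rewrite (meanB M14 M5) (meanD M13 M4) (meanD M12 M3) (meanB M1 M2).
by rewrite N1_mean N2_mean N3_mean N4_mean N5_mean !(subr0, addr0).
Qed.

Let cross_mean t :
  mean_le (fun w => (mean_delta t w - c) * (ds t.+1 w - c)) 0.
Proof.
split; last by rewrite N6_mean.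
apply: L2M; first by apply: L2B => //; exact: L2_cst.
by apply: L2B; [exact: ds_L2|exact: L2_cst].
Qed.

Let rate_ge0 : 0 <= 1 - a * lam0.
Proof.
have := ler_wpM2l (ltW a_gt0) (ltW lam0_lt1).
by rewrite mulr1; have := a_le; lra.
Qed.

(** The step starts at time [t.+1] because the noise and the drift refer back to [mean_delta t]. The
    constant 148 is 37 times the 4 from [(2 * K) ^+ 2]. *)
Let lyapunov_step t : mean (lyapunov t.+2) <=
  (1 - a * lam0) * mean (lyapunov t.+1)
  + (4 * K * ep + a ^+ 2 * (L_V ^+ 2 * sigma_V ^+ 2 / 2 + sigma_V ^+ 2
     + 48 * sigma_delta ^+ 2 + 48 * (L_V ^+ 2 * sigma_V ^+ 2)
     + 148 * (K ^+ 2 * G_V ^+ 2))).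
Proof.
have r0 := rate_ge0.
have a0 := ltW a_gt0; have a20 : 0 <= 2 * a by lra.
have a24 : 0 <= 24 * a ^+ 2 by have := sqr_ge0 a; lra.
have ah : 0 <= a / 2 by lra.
have lyap1 : mean_le (lyapunov t.+1) (mean (lyapunov t.+1)) by split.
have B1 := mean_leD (mean_leZ r0 lyap1) (mean_leZ a20 (noise_mean t)).
have B2 := mean_leD B1 (mean_leZ a24 (cross_mean t)).
have B3 := mean_leD B2 (mean_leZ ah (drift_mean t)).
have B4 := mean_leD (mean_leD B3 (mean_leZ (sqr_ge0 a) (tg_mean t.+1)))
  (mean_le_cst (4 * K * ep)).
have k48 : (0 : R) <= 48 by []. have k37 : (0 : R) <= 37 by [].
have B5 := mean_leD B4 (mean_leZ (sqr_ge0 a) (mean_leD (mean_leD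
  (mean_leZ k48 (td_error_mean t.+1)) (mean_leZ k48 (drift_mean t)))
  (mean_leZ k37 (ek_mean t.+1)))).
apply: (@le_trans _ _ _ _ _ _).
  apply: (ae_le_mean (lyapunov_L1 t.+2) B5.1).
  have [VK VsK] := bounded; apply: filterS VK => w VK.
  have := sqr_norm_step alg (fun=> ep_ge0) (fun=> lt0r_neq0 a_gt0) (VK t.+1) VsK.
  rewrite -/(e t.+2 w) -/(e t.+1 w) -/(tg t.+1 w) -delta_sub => step.
  have ev : ip H (e t.+1 w) (V t.+1 w) = `|e t.+1 w| ^+ 2 + ip H (e t.+1 w) Vstar.
    by rewrite -ip_norm -ipDr subrK.
  have z' : z t.+2 w = z t.+1 w + a * (delta t.+1 w - z t.+1 w).
    by rewrite (z_step alg); ring.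
  have := lyapunov_ineq c (mean_delta t.+1 w) (mean_delta t w)
    (dsb t.+1 w) a_gt0 a_le lam0_gt0 lam0_lt1 lam0_le (sqr_ge0 `|e t.+1 w|)
    ev z' step.
  rewrite /lyapunov /noise /= => /le_trans; apply.
  have -> : ek t.+1 w = delta t.+1 w - ds t.+1 w by rewrite deltaE addrAC subrr add0r.
  by lra.
apply: le_trans B5.2 _.
(* The drift already carries a factor [a ^+ 2], so its surplus powers of [a] are bounded by 1. *)
have : a ^+ 2 <= 1 by rewrite expr_le1//; have := a_le; lra.
have := mulr_ge0 (sqr_ge0 L_V) (sqr_ge0 sigma_V).
set X := L_V ^+ 2 * sigma_V ^+ 2 => X0 a21.
have -> : L_V ^+ 2 * (a ^+ 2 * sigma_V ^+ 2) = a ^+ 2 * X by rewrite /X; ring.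
have h1 : a / 2 * (a ^+ 2 * X) <= a ^+ 2 * (X / 2).
  have h := mulr_ge0 (sqr_ge0 a) X0.
  have := ler_wpM2r h (le_trans a_le (_ : 4^-1 <= 1)); rewrite mul1r.
  by rewrite invf_le1// ler1n => /(_ isT); lra.
have h2 : a ^+ 2 * (48 * (a ^+ 2 * X)) <= a ^+ 2 * (48 * X).
  rewrite ler_wpM2l ?sqr_ge0// ler_wpM2l// -[leRHS]mul1r ler_wpM2r//.
have -> : (2 * K) ^+ 2 * G_V ^+ 2 = 4 * (K ^+ 2 * G_V ^+ 2) by ring.
lra.
Qed.

Lemma sqr_dist_L1 t : L1 (fun w => `|V t w - Vstar| ^+ 2).
Proof. exact: e2_L1. Qed.

Lemma mean_sqr_dist_le_diam t :
  mean (fun w => `|V t w - Vstar| ^+ 2) <= (2 * K) ^+ 2.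
Proof.
rewrite -(mean_cst Pr ((2 * K) ^+ 2)).
apply: (ae_le_mean (e2_L1 t) (L1_cst Pr _)); apply: filterS e_bound => w eK.
by rewrite ler_sqr ?nnegrE// (le_trans _ (eK t)).
Qed.

(** [(a * lam0)^-1 * Q] is the fixed point of the affine recursion. The initial value, which may
    depend on the whole problem, only multiplies the geometric factor, so it can stay
    existential. *)
Lemma mean_sqr_dist_le : exists u1 : R, forall t,
  mean (fun w => `|V t.+1 w - Vstar| ^+ 2) <=
  (1 - a * lam0) ^+ t * u1 + (a * lam0)^-1 *
  (4 * K * ep + a ^+ 2 * (L_V ^+ 2 * sigma_V ^+ 2 / 2 + sigma_V ^+ 2
     + 48 * sigma_delta ^+ 2 + 48 * (L_V ^+ 2 * sigma_V ^+ 2)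
     + 148 * (K ^+ 2 * G_V ^+ 2))).
Proof.
set Q := 4 * K * ep + _; exists (`|mean (lyapunov 1)|) => t.
have r0 := rate_ge0.
have al : 0 < a * lam0 by rewrite mulr_gt0.
have Q0 : 0 <= Q.
  have h1 := mulr_ge0 (sqr_ge0 L_V) (sqr_ge0 sigma_V).
  have h2 := mulr_ge0 (sqr_ge0 K) (sqr_ge0 G_V).
  rewrite /Q addr_ge0// mulr_ge0 ?sqr_ge0 ?mulr_ge0 ?(ltW K_gt0)//.
  have := sqr_ge0 sigma_V; have := sqr_ge0 sigma_delta; lra.
have : mean (lyapunov t.+1) <=
    (1 - a * lam0) ^+ t * `|mean (lyapunov 1)| + (a * lam0)^-1 * Q.
  elim: t => [|t ih].
    rewrite expr0 mul1r (le_trans (ler_norm _))// lerDl mulr_ge0// invr_ge0.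
    exact: ltW.
  apply: le_trans (lyapunov_step t) _; rewrite -/Q.
  have := ler_wpM2l r0 ih; rewrite mulrDr mulrA -exprS => h.
  have E : (1 - a * lam0) * ((a * lam0)^-1 * Q) + Q = (a * lam0)^-1 * Q.
    by field; rewrite !gt_eqF.
  lra.
move=> h; apply: le_trans h; apply: (ae_le_mean (e2_L1 t.+1) (lyapunov_L1 t.+1)).
by apply: aeW => w; rewrite /lyapunov lerDl sqr_ge0.
Qed.

End Lyapunov.

(** * Passage to the limit and the two regimes of the step size *)

(** Each tail infimum lies below all later [b k], hence below their limit. The shift by one matches
    a recursion that starts at time 1. *)
Lemma limn_einf_le_cvg (R : realType) (u : nat -> \bar R) (b : nat -> R) (l : R) :
  (forall t, (u t.+1 <= (b t)%:E)%E) -> b @ \oo --> l -> (limn_einf u <= l%:E)%E.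
Proof.
move=> ub bl; rewrite limn_einf_lim; apply: lime_le; first exact: is_cvg_einfs.
apply: nearW => n.
have bl' : (b k)%:E @[k --> \oo] --> l%:E by apply: cvg_EFin => //; exact: nearW.
apply: cvge_ge bl'; exists n => // k /= nk; apply: le_trans (ub k).
by apply: ereal_inf_lbound; exists k.+1 => //=; exact: leqW.
Qed.

Theorem theorem2 (R : realType)
    (C lam0 sigma_delta G_delta G_V sigma_V L_V K : R) :
  0 < C -> 0 < lam0 -> lam0 < 1 ->
  0 < sigma_delta -> 0 < G_delta -> 0 < L_V -> 0 < K ->
  exists Bound : R,
  forall (p q : nat) (M : MDP R p q) (pi : policy M)
    (mu : state_distribution M) (H : RKHS (state M))
    (d : measure_display) (Omega : measurableType d)
    (Pr : probability Omega R)
    (xs : nat -> Omega -> 'rV[R]_p) (acts : nat -> Omega -> 'rV[R]_q)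
    (ys : nat -> Omega -> 'rV[R]_p)
    (V : nat -> Omega -> H) (z : nat -> Omega -> R)
    (D : nat -> Omega -> seq 'rV[R]_p)
    (alpha beta eps lam : R) (Vstar : H),
  0 < beta -> beta < 1 -> alpha = beta -> eps = C * alpha ^+ 2 ->
  lam = G_V ^+ 2 + lam0 ->
  iid_samples pi mu Pr xs acts ys ->
  pkgtd xs acts ys V z D (fun=> alpha) (fun=> beta) (fun=> eps) lam ->
  adapted_iterates xs acts ys V z ->
  (forall W : H, objective pi mu lam Vstar <= objective pi mu lam W) ->
  assumption1 H ->
  assumption2 Pr xs acts ys V z sigma_delta G_delta ->
  assumption3 pi mu Pr xs acts ys V z D (fun=> alpha) lam G_V sigma_V L_V ->
  norm_bound Pr V Vstar K ->
  (limn_einf (fun t => 'E_Pr[fun w => (`|V t w - Vstar| ^+ 2)%R])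
     <= (Bound * alpha)%:E)%E.
Proof.
move=> C0 l0 l1 _ _ _ K0.
(* With [eps = C * alpha ^+ 2] the error per step is [alpha ^+ 2 * Q]; dividing by [alpha * lam0]
   leaves [Q / lam0 * alpha]. *)
pose Q := 4 * K * C + (L_V ^+ 2 * sigma_V ^+ 2 / 2 + sigma_V ^+ 2
  + 48 * sigma_delta ^+ 2 + 48 * (L_V ^+ 2 * sigma_V ^+ 2)
  + 148 * (K ^+ 2 * G_V ^+ 2)).
have Q0 : 0 <= Q.
  have h1 := mulr_ge0 (sqr_ge0 L_V) (sqr_ge0 sigma_V).
  have h2 := mulr_ge0 (sqr_ge0 K) (sqr_ge0 G_V).
  have h3 := sqr_ge0 sigma_V; have h4 := sqr_ge0 sigma_delta.
  have h5 := mulr_gt0 K0 C0; rewrite /Q; lra.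
exists (Q / lam0 + 16 * K ^+ 2).
move=> p q M pi mu H d Omega Pr xs acts ys V z D alpha beta eps lam Vstar.
move=> a0 b1 ab epsE lamE iid alg adapted Vmin A1 A2 A3 bound; subst beta.
have ep0 : 0 <= eps by rewrite epsE mulr_ge0 ?sqr_ge0// ltW.
have ll : lam0 <= lam by rewrite lamE lerDr sqr_ge0.
have L := sqr_dist_L1 iid alg adapted A1 bound.
have Ql : 0 <= Q / lam0 by rewrite divr_ge0// ltW.
have EE t : ('E_Pr[fun w => (`|V t w - Vstar| ^+ 2)%R])%E =
    (mean Pr (fun w => `|V t w - Vstar| ^+ 2))%:E.
  by rewrite meanE// unlock.
have [a4|a4] := leP alpha 4^-1; last first.
  apply: (limn_einf_le_cvg (b := fun=> (Q / lam0 + 16 * K ^+ 2) * alpha)) => [t|].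
    rewrite EE lee_fin.
    apply: le_trans (mean_sqr_dist_le_diam iid alg adapted A1 bound t.+1) _.
    have K2 := sqr_ge0 K.
    have -> : (2 * K) ^+ 2 = 16 * K ^+ 2 * 4^-1 by field.
    have h1 : 16 * K ^+ 2 * 4^-1 <= 16 * K ^+ 2 * alpha.
      by apply: ler_wpM2l; [rewrite mulr_ge0|exact: ltW].
    apply: le_trans h1 _; rewrite ler_wpM2r ?lerDr//.
    exact: ltW.
  exact: cvg_cst.
have [u1 u1P] := mean_sqr_dist_le a0 a4 ep0 K0 l0 l1 ll iid alg adapted Vmin
  A1 A2 A3 bound.
have al : 0 < alpha * lam0 by rewrite mulr_gt0.
have al1 : alpha * lam0 < 1.
  have := ler_wpM2l (ltW a0) (ltW l1); rewrite mulr1 => h.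
  by rewrite (le_lt_trans h)// (le_lt_trans a4)// invf_lt1// ltr1n.
have h : ((Q / lam0 * alpha)%:E <= ((Q / lam0 + 16 * K ^+ 2) * alpha)%:E)%E.
  by rewrite lee_fin ler_wpM2r ?(ltW a0)// lerDl mulr_ge0// sqr_ge0.
apply: le_trans h.
apply: (limn_einf_le_cvg
  (b := fun t => (1 - alpha * lam0) ^+ t * u1 + Q / lam0 * alpha)) => [t|].
  rewrite EE lee_fin; apply: le_trans (u1P t) _; rewrite lerD2l epsE /Q.
  rewrite le_eqVlt; apply/orP; left; apply/eqP; field.
  by rewrite !gt_eqF.
rewrite -[X in _ --> X]add0r -[X in _ --> X + _](mul0r u1).
apply: cvgD; last exact: cvg_cst.
apply: cvgMl; apply: cvg_expr.
by rewrite ger0_norm; lra.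
Qed.
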